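(* Let $A$ and $B$ be positive definite operators on a Hilbert space $H$. If $r\geqslant 0$, $2p_0+\min\{1,r\}\geqslant p>p_0\geqslant 0$, for a positive integer $n$ such that $n(p+r)=(n+1)(p_0+r)$, the following assertions are equivalent. (3-1) $A\geqslant B>0$. (3-10) $\left(A^{\frac r2}B^{p_0}A^{\frac r2}\right)^{1+\frac1n}\geqslant A^{\frac r2}B^{p}A^{\frac r2}$. (3-11) There exists a unique $S>0$ with $\|S\|\leqslant 1$ such that $$\left(A^{\frac r2}B^{p_0}A^{\frac r2}\right)^{n+1}=\left(\left(A^{\frac r2}B^{p}A^{\frac r2}\right)^{\frac12}S^{-1}\left(A^{\frac r2}B^{p}A^{\frac r2}\right)^{\frac12}\right)^{n}.$$
   Context: Operators are bounded linear operators on a Hilbert space $H$. An operator $X$ is positive, $X\geqslant 0$, if $\langle Xx,x\rangle\geqslant 0$ for all $x\in H$; $X\geqslant Y$ means that $X,Y$ are self-adjoint and $X-Y\geqslant 0$. $X>0$ means that $X$ is positive definite (positive and invertible). Real powers of positive definite operators are taken by the continuous functional calculus; $\|\cdot\|$ is the operator norm.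
   Formalization: For fixed n, (3-1) is shown equivalent to (3-10), resp. (3-11), holding for all admissible r, p0, p, and (3-10) ⇔ (3-11) for each tuple; with r, p0, p fixed, (3-10) ⇒ (3-1) fails, e.g. r=0, p0=1, p=2, n=1, A=I, B=2I. *)

(* Defs.v *)
From HB Require Import structures.
From mathcomp Require Import all_boot all_order all_algebra.
From mathcomp Require Import sesquilinear.
From mathcomp Require Import all_classical all_reals all_analysis.
From mathcomp Require Import complex.

Set Implicit Arguments.
Unset Strict Implicit.
Unset Printing Implicit Defensive.

Import Order.TTheory GRing.Theory Num.Theory.
Import numFieldNormedType.Exports.

Local Open Scope classical_set_scope.
Local Open Scope ring_scope.
Local Open Scope complex_scope.

(* The inner product is linear in its first argument. *)
HB.mixin Record NormedModule_hasInner (R : realType) H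
    of NormedModule R[i] H := {
  inner : {dot H for (@Num.conj R[i])} ;
  norm_inner : forall x : H, `|x| ^+ 2 = inner x x }.

#[short(type="hilbertType")]
HB.structure Definition Hilbert (R : realType) :=
  { H of NormedModule_hasInner R H & CompleteNormedModule R[i] H }.

Notation "'[ x , y ]" := (inner x y) : ring_scope.

Section Operators.
Context {R : realType} {H : hilbertType R}.
Implicit Types T X Y : H -> H.

Definition bounded_op T : Prop :=
  linear T /\ exists M : R, forall x, `|T x| <= M%:C * `|x|.

(* Norms in H are elements of R[i] with zero imaginary part. *)
Definition opnorm T : R :=
  sup [set complex.Re `|T x| | x in [set x : H | `|x| <= 1]].

Definition self_adjoint T : Prop :=
  bounded_op T /\ forall x y, '[T x, y] = '[x, T y].

(* The order of R[i] makes [0 <= z] mean that z is real and nonnegative. *)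
Definition positive_op T : Prop :=
  bounded_op T /\ forall x, 0 <= '[T x, x].

Definition op_le Y X : Prop :=
  [/\ self_adjoint X, self_adjoint Y & positive_op (X \- Y)].

Definition is_op_inverse T X : Prop :=
  [/\ bounded_op X, cancel T X & cancel X T].

Definition op_invertible T : Prop := exists X, is_op_inverse T X.

(* Meaningful for invertible T. *)
Definition op_inv T : H -> H := xget (idfun : H -> H) [set X | is_op_inverse T X].

Definition positive_definite T : Prop := positive_op T /\ op_invertible T.

Definition spectrum T : set R[i] :=
  [set z | ~ op_invertible (fun x => T x - z *: x)].

Definition poly_op (q : {poly R}) T : H -> H :=
  fun x => \sum_(i < size q) (q`_i)%:C *: iter i T x.

(* Continuous functional calculus for a self-adjoint T, whose spectrum is real:
   f(T) is the operator-norm limit of q_k(T) for real polynomials q_k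
   converging to f uniformly on the spectrum of T. *)
Definition is_fun_calculus T (f : R -> R) X : Prop :=
  bounded_op X /\ exists q : nat -> {poly R},
    {uniform [set t : R | spectrum T t%:C],
      (fun k => horner (q k)) @ \oo --> f} /\
    (opnorm (poly_op (q k) T \- X) @[k --> \oo] --> (0 : R)).

Definition fun_calculus T (f : R -> R) : H -> H :=
  xget (idfun : H -> H) [set X | is_fun_calculus T f X].

Definition op_powR T (s : R) : H -> H := fun_calculus T (fun t => t `^ s).

(* A^(r/2) B^s A^(r/2) *)
Definition sandwich (A B : H -> H) (r s : R) : H -> H :=
  op_powR A (r / 2) \o op_powR B s \o op_powR A (r / 2).

Definition admissible (n : nat) (r p0 p : R) : Prop :=
  [/\ 0 <= r, p <= 2 * p0 + Num.min 1 r, p0 < p, 0 <= p0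
    & n%:R * (p + r) = n.+1%:R * (p0 + r)].

Definition power_inequality (A B : H -> H) (n : nat) (r p0 p : R) : Prop :=
  op_le (sandwich A B r p) (op_powR (sandwich A B r p0) (1 + n%:R^-1)).

(* The integer powers n+1 and n are iterated compositions. *)
Definition power_equation (A B : H -> H) (n : nat) (r p0 p : R) : Prop :=
  exists! S : H -> H,
    [/\ positive_definite S, opnorm S <= 1
      & iter n.+1 (sandwich A B r p0) =
        iter n (op_powR (sandwich A B r p) (1 / 2) \o op_inv S
                  \o op_powR (sandwich A B r p) (1 / 2))].

End Operators.

(* Main.v *)
From HB Require Import structures.
From mathcomp Require Import all_boot all_order all_algebra.
From mathcomp Require Import sesquilinear.
From mathcomp Require Import all_classical all_reals all_analysis.
From mathcomp Require Import complex.
Require Import Defs.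
From mathcomp Require Import ring lra.
Set Implicit Arguments.
Unset Strict Implicit.
Unset Printing Implicit Defensive.
Import Order.TTheory GRing.Theory Num.Theory.
Import numFieldNormedType.Exports.
Local Open Scope classical_set_scope.
Local Open Scope ring_scope.
Local Open Scope complex_scope.

(** Why the theorem is true.  Write X = A^(r/2) B^p0 A^(r/2), Y = A^(r/2) B^p A^(r/2)
    and Z = X^(1+1/n), so that the power inequality says
    Y <= Z.

    The power equation asks for a positive n-th root of X^(n+1) = Z^n of the form
    Y^(1/2) S^-1 Y^(1/2).  Positive n-th roots are unique, so this root is Z and
    S = Y^(1/2) Z^-1 Y^(1/2) is the only candidate; its norm is at most 1 iff S <= 1,
    iff Z^-1 <= Y^-1, iff Y <= Z ([power_equationP]).  Thus the inequality and the
    equation are equivalent for each single admissible triple.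

    With C = B^(p0/2) A^(r/2) and D = A^(r/2) B^(p0/2), its adjoint, one has X = D C and
    hence X^(1+1/n) = D (C D)^(1/n) C, whereas Y = D B^(p-p0) C.  Since
    p - p0 = (p0+r)/n, the inequality Y <= Z follows from
    (B^(p0/2) A^r B^(p0/2))^(1/n) >= B^((r+p0)/n), which is a case of the Furuta
    inequality, the hypothesis p <= 2 p0 + 1 being the condition under which Furuta's
    exponent 1/n is allowed ([ople_power_inequality]).  Conversely the triple
    r = n, p0 = 0, p = 1 turns the power inequality into A^(n/2) B A^(n/2) <= A^(n+1), that is
    B <= A ([power_inequality_ople]).

    The Furuta inequality ([furuta_inequality]) is reduced to the Loewner-Heinz
    inequality by the same factorisation for exponents r <= 1, and then bootstrapped
    along r |-> 2r+1.  Loewner-Heinz ([loewner_heinz]) is proved by Pedersen's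
    argument: the set of exponents for which it holds is closed under midpoints, as
    similar operators have the same spectrum, and under limits.

    The powers themselves rest on a functional calculus.  Its only analytic input is
    that a polynomial bounded by c on the spectrum of a self-adjoint T satisfies
    ||q(T)|| <= c ([poly_op_nbound_spectrum]): for self-adjoint S with m = ||S|| on a nonzero space, the
    operator S^2 - m^2 is not invertible, so q^2 - m^2, which splits into linear factors
    over the complex numbers, vanishes at some spectral point of T.  Together with
    polynomial approximation of t^s by Bernstein polynomials this yields existence,
    uniqueness, multiplicativity, monotonicity and the composition rule of powers.

    Invertibility is obtained throughout from coercivity of the quadratic form
    ([coercive_invertible]), a consequence of the contraction principle. *)

(** * The real inner product *)

Section HilbertSpace.
Context {R : realType} {H : hilbertType R}.
Implicit Types (x y z : H) (S T K : H -> H) (a b c : R) (k : R[i]).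
(** A bounded complex-linear operator is self-adjoint as soon as it is symmetric for the
    real part of the inner product, and then its quadratic form is real
    ([self_adjointP], [self_adjoint_real]).  Real estimates therefore suffice. *)
Definition rin x y : R := complex.Re '[x, y].
Definition nrm x : R := complex.Re `|x|.
Lemma nrmE x : `|x| = (nrm x)%:C.
Proof.
have := normr_ge0 x. rewrite /nrm; case: (`|x|) => u v /=.
rewrite lecE /= => /andP[/eqP -> _] //.
Qed.
Lemma nrm_ge0 x : 0 <= nrm x.
Proof. by have := normr_ge0 x; rewrite nrmE lecR. Qed.
Lemma nrmD x y : nrm (x + y) <= nrm x + nrm y.
Proof. by have := ler_normD x y; rewrite !nrmE -raddfD lecR. Qed.
Lemma nrmB_sym x y : nrm (x - y) = nrm (y - x).
Proof. by rewrite /nrm distrC. Qed.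
Lemma nrmN x : nrm (- x) = nrm x.
Proof. by rewrite /nrm normrN. Qed.
Lemma nrm0 : nrm 0 = 0.
Proof. by rewrite /nrm normr0. Qed.
Lemma nrm_eq0 x : nrm x = 0 -> x = 0.
Proof. by move=> h; apply/eqP; rewrite -normr_eq0 nrmE h. Qed.
Lemma nrm_gt0 x : x != 0 -> 0 < nrm x.
Proof.
by move=> x0; rewrite lt_neqAle nrm_ge0 andbT eq_sym; apply: contra x0 => /eqP/nrm_eq0->.
Qed.
Lemma nrmZ a x : nrm (a%:C *: x) = `|a| * nrm x.
Proof.
by rewrite /nrm normrZ normc_def /= expr0n addr0 sqrtr_sqr [`|x|]nrmE /=; ring.
Qed.
Lemma nrmX x : nrm x ^+ 2 = rin x x.
Proof. by rewrite /rin -norm_inner nrmE -rmorphXn. Qed.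
Lemma conjE k : Num.conj k = conjc k.
Proof. by []. Qed.
Lemma ReJ k : complex.Re (Num.conj k) = complex.Re k.
Proof. by rewrite conjE; case: k. Qed.
Lemma rinC x y : rin x y = rin y x.
Proof. by rewrite /rin hermC expr0 mul1r ReJ. Qed.
Lemma rinDl x y z : rin (x + y) z = rin x z + rin y z.
Proof. by rewrite /rin linearDl raddfD. Qed.

Lemma ReZ a k : complex.Re (a%:C * k) = a * complex.Re k.
Proof. by case: k => u v /=; ring. Qed.
Lemma rinZl a x y : rin (a%:C *: x) y = a * rin x y.
Proof. by rewrite /rin linearZl_LR ReZ. Qed.
Lemma innerZi x y : '[('i)%C *: x, y] = 'i%C * '[x,y].
Proof. exact: linearZl_LR. Qed.
Lemma innerZir x y : '[x, ('i)%C *: y] = - 'i%C * '[x,y].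
Proof.
rewrite linearZr_LR /= conjE; congr (_ * _).
by apply/eqP; rewrite eq_complex /= oppr0 !eqxx.
Qed.
(** The imaginary part is a real part too: Re(i z) = - Im z. *)
Lemma inner_rin x y : '[x, y] = (rin x y)%:C - 'i%C * (rin ('i%C *: x) y)%:C.
Proof.
rewrite /rin innerZi {1}(complexE '[x,y]); congr (_ + _).
by rewrite -mulrN -rmorphN /=; congr (_ * _%:C); rewrite mulrC ReiNIm opprK.
Qed.
Lemma rinZi x y : rin ('i%C *: x) ('i%C *: y) = rin x y.
Proof. by rewrite /rin innerZi innerZir mulrA mulrN -expr2 sqr_i opprK mul1r. Qed.
Lemma rinDr x y z : rin x (y + z) = rin x y + rin x z.
Proof. by rewrite rinC rinDl !(rinC x). Qed.
Lemma rinZr a x y : rin x (a%:C *: y) = a * rin x y.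
Proof. by rewrite rinC rinZl rinC. Qed.
Lemma rinNl x y : rin (- x) y = - rin x y.
Proof. by rewrite /rin linearNl raddfN. Qed.
Lemma rinNr x y : rin x (- y) = - rin x y.
Proof. by rewrite rinC rinNl rinC. Qed.
Definition rinE := (rinDl, rinDr, rinNl, rinNr, rinZl, rinZr).
Lemma rin0l x : rin 0 x = 0.
Proof. by rewrite -[0](subrr x) rinDl rinNl subrr. Qed.

(** Expand the square norm of |y| x - |x| y. *)
Lemma cauchy_schwarz x y : rin x y <= nrm x * nrm y.
Proof.
have [->|y0] := eqVneq y 0; first by rewrite rinC rin0l nrm0 mulr0.
have ny := nrm_gt0 y0.
have := sqr_ge0 (nrm ((nrm y)%:C *: x - (nrm x)%:C *: y)).
rewrite nrmX !rinE -!nrmX (rinC y x) => h.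
have [->|x0] := eqVneq x 0; first by rewrite rin0l nrm0 mul0r.
have nx := nrm_gt0 x0.
have hp : 0 < nrm x * nrm y by exact: mulr_gt0.
rewrite -(ler_pM2l hp); nra.
Qed.

Definition nbound (T : H -> H) c := forall x, nrm (T x) <= c * nrm x.
Definition symm (T : H -> H) := forall x y, rin (T x) y = rin x (T y).
(** The comparison of quadratic forms, without self-adjointness; see [op_leE]. *)
Definition ople (T U : H -> H) := forall x, rin (T x) x <= rin (U x) x.

Lemma bounded_opP (T : H -> H) :
  bounded_op T <-> linear T /\ exists2 c, 0 < c & nbound T c.
Proof.
split=> -[hl [c]].
  move=> h; split=> //; exists (`|c| + 1); first by rewrite ltr_wpDl.
  move=> x; have := h x; rewrite !nrmE -rmorphM lecR => /le_trans; apply.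
  by apply: ler_wpM2r; rewrite ?nrm_ge0 // (le_trans (ler_norm _)) // lerDl.
move=> _ h; split=> //; exists c => x.
by rewrite !nrmE -rmorphM lecR; exact: h.
Qed.

Lemma linD (T : H -> H) : linear T -> {morph T : x y / x + y}.
Proof. by move=> h x y; have := h 1 x y; rewrite !scale1r. Qed.
Lemma lin0 (T : H -> H) : linear T -> T 0 = 0.
Proof. by move=> h; apply: (addIr (T 0)); rewrite -(linD h) !add0r. Qed.
Lemma linZ (T : H -> H) : linear T -> forall k x, T (k *: x) = k *: T x.
Proof. by move=> h k x; have := h k x 0; rewrite !addr0 (lin0 h) addr0. Qed.
Lemma linN (T : H -> H) : linear T -> {morph T : x / - x}.
Proof. by move=> h x; rewrite -scaleN1r (linZ h) scaleN1r. Qed.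
Lemma linB (T : H -> H) : linear T -> {morph T : x y / x - y}.
Proof. by move=> h x y; rewrite (linD h) (linN h). Qed.

Lemma self_adjointP (T : H -> H) : self_adjoint T <-> bounded_op T /\ symm T.
Proof.
split=> -[hb h]; split=> // x y; first by rewrite /rin h.
rewrite inner_rin [RHS]inner_rin h; congr (_ - _ * _%:C).
by rewrite -(linZ hb.1) h.
Qed.

(** * Completeness and coercive operators *)

Lemma nrm_cauchy (u : nat -> H) :
  (forall e : R, 0 < e -> exists N, forall m n, (N <= m)%N -> (N <= n)%N ->
     nrm (u m - u n) <= e) ->
  exists l, forall e : R, 0 < e -> exists N, forall n, (N <= n)%N ->
     nrm (u n - l) <= e.
Proof.
move=> hu.
have gtC (e : R[i]) : 0 < e -> exists2 e' : R, 0 < e' & e = e'%:C.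
  case: e => a b; rewrite ltcE /= => /andP[/eqP -> a0]; by exists a.
have cu : cvg (u @ \oo).
  apply/cauchy_cvgP/cauchyP => e /gtC[e' e0 ->].
  have [N hN] := hu (e' / 2) ltac:(lra).
  exists (u N); exists N => // n /= Nn; rewrite -ball_normE /=.
  rewrite nrmE ltcR; apply: le_lt_trans (hN N n _ _) _ => //; lra.
exists (lim (u @ \oo)) => e e0.
have /cvgrPdist_le/(_ e%:C) := cu; rewrite ltcR => /(_ e0)[N _ hN].
by exists N => n Nn; have := hN n Nn; rewrite /= nrmE lecR nrmB_sym.
Qed.

Lemma exp_small c d e : 0 <= c < 1 -> 0 <= d -> 0 < e ->
  exists N, forall n, (N <= n)%N -> c ^+ n * d <= e.
Proof.
move=> /andP[c0 c1] d0 e0.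
have h : (GRing.exp c : R ^nat) @ \oo --> (0 : R) by apply: cvg_expr; rewrite ger0_norm.
have ed : 0 < e / (d + 1) by apply: divr_gt0 => //; lra.
have /cvgrPdist_le/(_ _ ed)[N _ hN] := h; exists N => n Nn.
have := hN n Nn; rewrite /= sub0r normrN ger0_norm ?exprn_ge0 // => hn.
apply: le_trans (ler_wpM2r d0 hn) _; rewrite mulrAC ler_pdivrMr; last lra.
by rewrite ler_pM2l //; lra.
Qed.

Lemma contraction_fixpoint (F : H -> H) c : 0 <= c < 1 ->
  (forall x y, nrm (F x - F y) <= c * nrm (x - y)) -> exists x, F x = x.
Proof.
move=> /andP[c0 c1] hF; pose u n := iter n F 0; pose d := nrm (F 0 - 0).
have d0 : 0 <= d := nrm_ge0 _.
have step n : nrm (F (u n) - u n) <= c ^+ n * d.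
  elim: n => [|n IHn]; first by rewrite mul1r.
  by rewrite exprS -mulrA; apply: le_trans (hF _ _) _; apply: ler_wpM2l.
(* The defects of two points control their distance, so the iterates, whose defects
     decay geometrically, are Cauchy without summing a series. *)
have key x y : (1 - c) * nrm (x - y) <= nrm (F x - x) + nrm (F y - y).
  have h1 := nrmD (x - F x + (F x - F y)) (F y - y).
  have h2 := nrmD (x - F x) (F x - F y); have := hF x y.
  rewrite (nrmB_sym x (F x)) in h2.
  move=> h3.
  have : nrm (x - y) = nrm (x - F x + (F x - F y) + (F y - y)).
    by congr nrm; rewrite !addrA !subrK.
  lra.
have [|l hl] := @nrm_cauchy u.
  move=> e e0; have [||N hN] := @exp_small c d ((1 - c) * e / 2) _ d0.
  - by rewrite c0.
  - by apply: divr_gt0 => //; apply: mulr_gt0 => //; lra.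
  exists N => m n Nm Nn; have := key (u m) (u n).
  have := step m; have := step n; have := hN _ Nm; have := hN _ Nn => *.
  have : (1 - c) * nrm (u m - u n) <= (1 - c) * e by lra.
  by rewrite ler_pM2l //; lra.
exists l; apply/eqP; rewrite -subr_eq0; apply/eqP/nrm_eq0.
apply/eqP; rewrite eq_le nrm_ge0 andbT; apply/ler_addgt0Pl => e e0; rewrite addr0.
have [N hN] := hl (e / 2) ltac:(lra).
have := hN _ (leqnn N); have := hN _ (leqnSn N).
have -> : F l - l = (F l - F (u N)) + (u N.+1 - l) by rewrite addrA subrK.
move=> h1 h2; apply: le_trans (nrmD _ _) _; have := hF l (u N).
rewrite (nrmB_sym l); have := nrm_ge0 (u N - l); nra.
Qed.

Lemma bounded_below_invertible (T : H -> H) d : bounded_op T -> 0 < d ->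
  (forall x, d * nrm x <= nrm (T x)) -> (forall y, exists x, T x = y) ->
  op_invertible T.
Proof.
move=> /[dup] hb [hl _] d0 hd sT.
have inj : injective T.
  move=> x y exy; apply/eqP; rewrite -subr_eq0; apply/eqP/nrm_eq0.
  have := hd (x - y); rewrite (linB hl) exy subrr nrm0 => h.
  by apply/eqP; rewrite eq_le nrm_ge0 andbT -(pmulr_rle0 _ d0).
have [X hX] := choice sT; exists X.
have XK : cancel X T by [].
have KX : cancel T X by move=> x; apply: inj.
split=> //; apply/bounded_opP; split.
  by move=> k x y; apply: inj; rewrite hl !XK.
exists d^-1; first by rewrite invr_gt0.
by move=> x; rewrite -(ler_pM2l d0) mulVKf ?gt_eqF // -{2}(XK x).
Qed.

(** The Lax-Milgram argument: T x = y iff x is fixed by x |-> x - t (T x - y), and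
    |z - t T z|^2 <= (1 - 2 t d + t^2 M^2) |z|^2, which is a contraction for t = d/M^2. *)
Lemma coercive_invertible (T : H -> H) d : bounded_op T -> 0 < d ->
  (forall x, d * nrm x ^+ 2 <= rin (T x) x) -> op_invertible T.
Proof.
move=> /[dup] hb /bounded_opP[hl [M0 M0p hM0]] d0 hd.
have hd' x : d * nrm x <= nrm (T x).
  have := nrm_ge0 x; rewrite le_eqVlt => /orP[/eqP <-|x0].
    by rewrite mulr0 nrm_ge0.
  by rewrite -(ler_pM2r x0); have := hd x; have := cauchy_schwarz (T x) x; lra.
apply: (bounded_below_invertible hb d0 hd') => y.
(* Enlarging the bound past d keeps 1 - d^2/M^2 nonnegative. *)
pose M := M0 + d; have Mp : 0 < M by rewrite /M; lra.
have hM x : nrm (T x) <= M * nrm x.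
  by have := hM0 x; have := nrm_ge0 x; rewrite /M; nra.
pose t := d / M ^+ 2; pose c := 1 - d ^+ 2 / M ^+ 2.
have M2 : 0 < M ^+ 2 by rewrite exprn_gt0.
have tp : 0 < t by rewrite divr_gt0.
have c0 : 0 <= c.
  by rewrite /c subr_ge0 ler_pdivrMr // mul1r ler_sqr ?nnegrE /M; lra.
have c1 : c < 1 by rewrite /c ltrBlDr ltrDl divr_gt0 // exprn_gt0.
have [||x hx] := @contraction_fixpoint (fun x => x - t%:C *: (T x - y)) (Num.sqrt c).
- by rewrite sqrtr_ge0 -sqrtr1 ltr_sqrt.
- move=> x1 x2; set z := x1 - x2.
  have -> : x1 - t%:C *: (T x1 - y) - (x2 - t%:C *: (T x2 - y)) = z - t%:C *: T z.
    rewrite opprD opprK addrACA; congr (_ + _).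
    rewrite -[LHS]opprK opprD opprK -scalerBr; congr (- (_ *: _)).
    by rewrite (linB hl) opprB addrA subrK.
  rewrite -ler_sqr ?nnegrE ?nrm_ge0 ?mulr_ge0 ?nrm_ge0 ?sqrtr_ge0 //.
  rewrite exprMn sqr_sqrtr //; clearbody z.
  rewrite (nrmX (z - _)) !rinE -!nrmX (rinC z (T z)).
  have h1 := hd z; have h2 := hM z.
  have h3 : nrm (T z) ^+ 2 <= M ^+ 2 * nrm z ^+ 2.
    by rewrite -exprMn ler_sqr ?nnegrE ?nrm_ge0 ?mulr_ge0 ?nrm_ge0 // ltW.
  have h4 : t * (t * nrm (T z) ^+ 2) <= t * (t * (M ^+ 2 * nrm z ^+ 2)) by rewrite !ler_pM2l.
  have h5 : t * (d * nrm z ^+ 2) <= t * rin (T z) z by rewrite ler_pM2l.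
  have e1 : t * (t * (M ^+ 2 * nrm z ^+ 2)) = t * (d * nrm z ^+ 2).
    by rewrite /t; field; exact: lt0r_neq0.
  have e2 : c * nrm z ^+ 2 = nrm z ^+ 2 - t * (d * nrm z ^+ 2).
    rewrite /c /t; field; exact: lt0r_neq0.
  lra.
exists x; have : t%:C *: (T x - y) = 0 by rewrite -[LHS](subKr x) hx subrr.
by move/eqP; rewrite scaler_eq0 => /orP[/eqP[t0]|]; [exfalso; case: t0 => t0; lra|rewrite subr_eq0 => /eqP].
Qed.

(** * Bounded operators *)

Lemma nrmZc k x : nrm (k *: x) = complex.Re `|k| * nrm x.
Proof. by rewrite /nrm normrZ nrmE normc_def -rmorphM. Qed.

Lemma bounded_id : bounded_op (idfun : H -> H).
Proof. by apply/bounded_opP; split=> //; exists 1 => // x; rewrite mul1r. Qed.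

Lemma bounded_comp (S T : H -> H) :
  bounded_op S -> bounded_op T -> bounded_op (S \o T).
Proof.
move=> /bounded_opP[lS [c c0 hc]] /bounded_opP[lT [d d0 hd]].
apply/bounded_opP; split; first by move=> k x y /=; rewrite lT lS.
exists (c * d) => [|x /=]; first exact: mulr_gt0.
by apply: le_trans (hc _) _; rewrite -mulrA ler_pM2l.
Qed.

Lemma bounded_add (S T : H -> H) :
  bounded_op S -> bounded_op T -> bounded_op (fun x => S x + T x).
Proof.
move=> /bounded_opP[lS [c c0 hc]] /bounded_opP[lT [d d0 hd]].
apply/bounded_opP; split.
  by move=> k x y /=; rewrite lT lS scalerDr addrACA.
exists (c + d) => [|x /=]; first exact: addr_gt0.
by apply: le_trans (nrmD _ _) _; rewrite mulrDl lerD.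
Qed.

Lemma bounded_scale k (T : H -> H) :
  bounded_op T -> bounded_op (fun x => k *: T x).
Proof.
move=> /bounded_opP[lT [c c0 hc]]; apply/bounded_opP; split.
  by move=> l x y /=; rewrite lT scalerDr !scalerA mulrC.
have k0 : 0 <= complex.Re `|k| by rewrite normc_def sqrtr_ge0.
exists ((complex.Re `|k| + 1) * c) => [|x]; first by rewrite mulr_gt0 // ltr_wpDl.
rewrite nrmZc -mulrA; apply: ler_pM; rewrite ?nrm_ge0 // lerDl //.
Qed.

Lemma bounded_sub (S T : H -> H) :
  bounded_op S -> bounded_op T -> bounded_op (fun x => S x - T x).
Proof.
move=> hS hT; rewrite (_ : (fun x => _) = fun x => S x + (-1) *: T x).
  by apply: bounded_add => //; exact: bounded_scale.
by apply/funext => x; rewrite scaleN1r.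
Qed.

Lemma invertible_comp (S T : H -> H) :
  op_invertible S -> op_invertible T -> op_invertible (S \o T).
Proof.
move=> [X [bX SX XS]] [Y [bY TY YT]]; exists (Y \o X).
by split; [exact: bounded_comp| move=> x /=; rewrite SX TY | move=> x /=; rewrite YT XS].
Qed.

Lemma invertible_scale k (T : H -> H) : k != 0 ->
  op_invertible (fun x => k *: T x) -> op_invertible T.
Proof.
move=> k0 [X [bX TX XT]]; exists (X \o (fun x => k *: x)); split=> [||x /=].
- by apply: bounded_comp => //; apply: bounded_scale bounded_id.
- by move=> x /=; rewrite TX.
- by apply: (scalerI k0); rewrite XT.
Qed.

(** * Polynomials of an operator and its spectrum *)

Implicit Types p q : {poly R[i]}.
(** Complex coefficients are needed to split a real polynomial into linear factors. *)
Definition cpoly_op (p : {poly R[i]}) (T : H -> H) : H -> H :=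
  fun x => \sum_(i < size p) p`_i *: iter i T x.

Lemma cpoly_op_widen N p T x : (size p <= N)%N ->
  cpoly_op p T x = \sum_(i < N) p`_i *: iter i T x.
Proof.
move=> hN; rewrite /cpoly_op (big_ord_widen N (fun i => p`_i *: iter i T x)) //.
rewrite big_mkcond /=; apply: eq_bigr => i _; case: ifPn => //.
by rewrite -leqNgt => hi; rewrite nth_default // scale0r.
Qed.

Lemma cpoly_opD p q T x : cpoly_op (p + q) T x = cpoly_op p T x + cpoly_op q T x.
Proof.
pose N := maxn (size p) (size q).
rewrite !(@cpoly_op_widen N) ?leq_maxl ?leq_maxr ?size_polyD // -big_split /=.
by apply: eq_bigr => i _; rewrite coefD scalerDl.
Qed.

Lemma cpoly_opC k T x : cpoly_op k%:P T x = k *: x.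
Proof.
rewrite (@cpoly_op_widen 1) ?size_polyC ?leq_b1 // big_ord1 coefC //.
Qed.

Lemma cpoly_opMX p T x : cpoly_op (p * 'X) T x = cpoly_op p T (T x).
Proof.
have hs : (size (p * 'X)%R <= (size p).+1)%N.
  by apply: leq_trans (size_polyMleq _ _) _; rewrite size_polyX addn2.
rewrite (cpoly_op_widen _ _ hs) big_ord_recl coefMX scale0r add0r.
by apply: eq_bigr => i _; rewrite coefMX /= -iterSr.
Qed.

Lemma cpoly_opZ k q T x : cpoly_op (k *: q) T x = k *: cpoly_op q T x.
Proof.
rewrite (@cpoly_op_widen (size q)) ?size_scale_leq // scaler_sumr.
by apply: eq_bigr => i _; rewrite coefZ scalerA.
Qed.

Lemma cpoly_opS p k T x :
  cpoly_op (p * 'X + k%:P) T x = cpoly_op p T (T x) + k *: x.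
Proof. by rewrite cpoly_opD cpoly_opMX cpoly_opC. Qed.

Lemma cpoly_op0 T x : cpoly_op 0 T x = 0.
Proof. by rewrite -(polyC0 R[i]) cpoly_opC scale0r. Qed.

Lemma cpoly_op_bounded p T : bounded_op T -> bounded_op (cpoly_op p T).
Proof.
move=> bT; elim/poly_ind: p => [|p k IHp].
  rewrite (_ : cpoly_op 0 T = fun x => 0 *: x).
    exact: bounded_scale bounded_id.
  by apply/funext => x; rewrite cpoly_op0 scale0r.
rewrite (_ : cpoly_op _ T = fun x => (cpoly_op p T \o T) x + k *: x).
  by apply: bounded_add; [exact: bounded_comp|exact: bounded_scale bounded_id].
by apply/funext => x; rewrite cpoly_opS.
Qed.

(** Taking K = S = T also shows that T commutes with its polynomials. *)
Lemma cpoly_op_intertwine p (S T K : H -> H) : linear K ->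
  (forall x, S (K x) = K (T x)) ->
  forall x, cpoly_op p S (K x) = K (cpoly_op p T x).
Proof.
move=> lK hK; elim/poly_ind: p => [|p k IHp] x.
  by rewrite !cpoly_op0 (lin0 lK).
by rewrite !cpoly_opS hK IHp (linD lK) (linZ lK).
Qed.

Lemma cpoly_opM p q T : linear T ->
  forall x, cpoly_op (p * q) T x = cpoly_op p T (cpoly_op q T x).
Proof.
move=> lT; elim/poly_ind: p => [|p k IHp] x; first by rewrite mul0r !cpoly_op0.
rewrite cpoly_opS mulrDl mulrAC cpoly_opD cpoly_opMX IHp mul_polyC.
rewrite (@cpoly_op_intertwine q T T T lT) //.
by rewrite cpoly_opZ.
Qed.

(** If no root of p lay in the spectrum, p(T) would be a product of invertible
    factors T - z. *)
Lemma cpoly_op_spectrum p T : bounded_op T -> p != 0 ->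
  ~ op_invertible (cpoly_op p T) -> exists2 z, root p z & spectrum T z.
Proof.
move=> bT p0; apply: contra_notP => hz.
have [r hr] := closed_field_poly_normal p.
have {}hz (z : R[i]) : z \in r -> op_invertible (fun x => T x - z *: x).
  move=> zr; apply: contrapT => hT; apply: hz; exists z => //.
  by rewrite hr rootZ ?lead_coef_eq0 // root_prod_XsubC.
have idI : op_invertible (idfun : H -> H) by exists idfun; split => //; exact: bounded_id.
have hprod : op_invertible (cpoly_op (\prod_(z <- r) ('X - z%:P)) T).
  elim: r hz {hr} => [|z r IHr] hz.
    rewrite big_nil (_ : cpoly_op 1 T = idfun) //.
    by apply/funext => x; rewrite cpoly_opC scale1r.
  rewrite big_cons mulrC; set q := \prod_(_ <- _) _ in IHr *.
  rewrite (_ : cpoly_op _ T = cpoly_op q T \o (fun x => T x - z *: x)).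
    apply: invertible_comp; last by apply: hz; rewrite mem_head.
    by apply: IHr => y yr; apply: hz; rewrite in_cons yr orbT.
  apply/funext => x; rewrite cpoly_opM /=; last exact: bT.1.
  congr (cpoly_op q T _).
  by rewrite -[X in X - _]mul1r -polyCN cpoly_opS -(polyC1 R[i]) cpoly_opC scale1r scaleNr.
rewrite hr; set q := \prod_(_ <- _) _ in hprod *.
rewrite -mul_polyC (_ : cpoly_op _ T = (fun x => lead_coef p *: x) \o cpoly_op q T).
  apply: invertible_comp => //; apply: (@invertible_scale (lead_coef p)^-1).
    by rewrite invr_eq0 lead_coef_eq0.
  by under eq_fun do rewrite scalerA mulVf ?lead_coef_eq0 // scale1r.
by apply/funext => x; rewrite cpoly_opM ?cpoly_opC //; exact: bT.1.
Qed.

(** The factor l rotates a form whose sign or direction is wrong: l = -1 handles real k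
    above the form, l = +-i nonreal k. *)
Lemma coercive_shift_invertible (T : H -> H) (k l : R[i]) d : bounded_op T ->
  0 < d -> (forall x, d * nrm x ^+ 2 <= rin (l *: (T x - k *: x)) x) ->
  l != 0 -> op_invertible (fun x => T x - k *: x).
Proof.
move=> bT d0 hd l0; apply: (invertible_scale l0).
apply: (coercive_invertible _ d0 hd); apply: bounded_scale.
by apply: bounded_sub => //; exact: bounded_scale bounded_id.
Qed.

Lemma inner_conj x y : Num.conj '[x, y] = '[y, x].
Proof. by rewrite [RHS]hermC expr0 mul1r. Qed.

Lemma self_adjoint_real T x : self_adjoint T -> '[T x, x] = (rin (T x) x)%:C.
Proof.
move=> [_ sT]; have : Num.conj '[T x, x] = '[T x, x] by rewrite inner_conj sT.
rewrite /rin conjE; case: ('[_, _]) => u v /= [] hv.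
by apply/eqP; rewrite eq_complex /= eqxx /=; apply/eqP; lra.
Qed.

Lemma self_adjoint_shift T a : self_adjoint T -> self_adjoint (fun x => T x - a%:C *: x).
Proof.
move=> /self_adjointP[bT sT]; apply/self_adjointP; split.
  by apply: bounded_sub => //; exact: bounded_scale bounded_id.
by move=> x y; rewrite !rinE sT.
Qed.

(** For k = a + i b the form of i (T - k) is b |x|^2, since i (T - a) has real part zero. *)
Lemma spectrum_real (T : H -> H) (z : R[i]) : self_adjoint T -> spectrum T z ->
  z = (complex.Re z)%:C.
Proof.
move=> /[dup] saT /self_adjointP[bT sT] hz; case: z hz => a b hz /=.
apply/eqP; rewrite eq_complex /= eqxx /=; apply/negPn/negP => b0; apply: hz.
have := b0; rewrite neq_lt => hb; pose s : R := if b < 0 then -1 else 1.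
have hs : s * b = `|b|.
  rewrite /s; case: ifPn => h; first by rewrite mulN1r ltr0_norm.
  by rewrite mul1r ger0_norm // leNgt.
apply: (@coercive_shift_invertible T _ (s%:C * 'i%C) `|b|) => //.
- by rewrite normr_gt0.
- move=> x; rewrite le_eqVlt; apply/orP; left; apply/eqP.
  have im0 : rin ('i%C *: (T x - a%:C *: x)) x = 0.
    have h := self_adjoint_real x (self_adjoint_shift a saT).
    by rewrite /rin innerZi h /= mul0r mul1r subr0.
  have -> : (s%:C * 'i%C) *: (T x - (a +i* b) *: x)
          = s%:C *: ('i%C *: (T x - a%:C *: x)) + (s * b)%:C *: x.
    rewrite -scalerA (_ : a +i* b = a%:C + 'i%C * b%:C); last exact: complexE.
    rewrite scalerDl opprD addrA [in LHS]scalerBr [in LHS]scalerDr; congr (_ + _).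
    rewrite -scalerN -scaleNr !scalerA; congr (_ *: _).
    by rewrite rmorphM mulrN mulrA -(mulrA s%:C) -expr2 sqr_i mulrN1 mulNr opprK.
  by rewrite rinDl rinZl im0 mulr0 add0r rinZl -nrmX hs.
- rewrite mulf_eq0 negb_or; apply/andP; split.
    rewrite /s; case: ifP => _; rewrite eq_complex /= ?oppr_eq0 oner_eq0 //.
  by rewrite eq_complex /= oner_eq0 andbF.
Qed.

(** * The norm of a polynomial in a self-adjoint operator *)

Definition between (T : H -> H) a b :=
  forall x, a * nrm x ^+ 2 <= rin (T x) x <= b * nrm x ^+ 2.

Lemma spectrum_between (T : H -> H) a b t : self_adjoint T -> between T a b ->
  spectrum T t%:C -> a <= t <= b.
Proof.
move=> /self_adjointP[bT sT] hT ht.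
rewrite !leNgt; apply/andP; split; apply/negP => h; apply: ht.
  apply: (@coercive_shift_invertible T _ 1 (a - t)) => //; rewrite ?subr_gt0 ?oner_eq0 //.
  move=> x; have /andP[h1 _] := hT x.
  by rewrite scale1r rinDl rinNl rinZl -nrmX; lra.
apply: (@coercive_shift_invertible T _ (-1) (t - b)) => //; rewrite ?subr_gt0 ?oppr_eq0 ?oner_eq0 //.
move=> x; have /andP[_ h1] := hT x.
by rewrite scaleN1r rinNl rinDl rinNl rinZl -nrmX; lra.
Qed.

Lemma opnorm_has_sup (T : H -> H) : bounded_op T ->
  has_sup [set complex.Re `|T x| | x in [set x : H | `|x| <= 1]].
Proof.
move=> /bounded_opP[lT [c c0 hc]]; split.
  by exists (nrm (T 0)), 0 => //=; rewrite normr0.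
exists c => _ [x /= hx <-]; apply: le_trans (hc x) _.
by move: hx; rewrite nrmE lecR => /(ler_wpM2l (ltW c0)); rewrite mulr1.
Qed.

Lemma opnorm_nbound (T : H -> H) : bounded_op T -> nbound T (opnorm T).
Proof.
move=> bT x; have [->|x0] := eqVneq x 0; first by rewrite (lin0 bT.1) nrm0 mulr0.
have nx := nrm_gt0 x0.
have := ub_le_sup (opnorm_has_sup bT).2; move=> /(_ (nrm (T ((nrm x)^-1%:C *: x)))).
have ni : 0 <= (nrm x)^-1 by rewrite invr_ge0 ltW.
have h : [set complex.Re `|T x| | x in [set x : H | `|x| <= 1]]
    (nrm (T ((nrm x)^-1%:C *: x))).
  exists ((nrm x)^-1%:C *: x) => //=.
  by rewrite nrmE lecR nrmZ ger0_norm // mulVf // gt_eqF.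
move=> /(_ h); rewrite (linZ bT.1) nrmZ ger0_norm // => h2.
by rewrite mulrC -ler_pdivrMl.
Qed.

Lemma opnorm_le (T : H -> H) c : bounded_op T -> 0 <= c -> nbound T c -> opnorm T <= c.
Proof.
move=> bT c0 hc; apply: ge_sup; first by have [] := opnorm_has_sup bT.
move=> _ [x /= hx <-]; apply: le_trans (hc x) _.
by move: hx; rewrite nrmE lecR => /(ler_wpM2l c0); rewrite mulr1.
Qed.

Lemma opnorm_ge0 (T : H -> H) : bounded_op T -> 0 <= opnorm T.
Proof.
move=> bT; apply: (ub_le_sup (opnorm_has_sup bT).2); exists 0; rewrite /= ?normr0 //.
by rewrite (lin0 bT.1) normr0.
Qed.

(** With m = ||S|| one has |(S^2 - m^2) y|^2 <= m^2 (m^2 |y|^2 - |S y|^2).  A bounded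
    inverse of S^2 - m^2 therefore gives |S y|^2 <= (m^2 - e) |y|^2 for a fixed e > 0,
    which contradicts the definition of m unless the space is zero. *)
Lemma sqr_opnorm_spectrum (S : H -> H) : self_adjoint S ->
  op_invertible (fun x => S (S x) - (opnorm S ^+ 2)%:C *: x) ->
  forall x : H, x = 0.
Proof.
move=> /self_adjointP[bS sS] [X [/bounded_opP[_ [K K0 hK]] XS _]] x.
set m := opnorm S in XS *.
have m0 : 0 <= m by exact: opnorm_ge0.
have hm : nbound S m by exact: opnorm_nbound.
have hk y : nrm y ^+ 2 <= K ^+ 2 * (m ^+ 2 * (m ^+ 2 * nrm y ^+ 2 - nrm (S y) ^+ 2)).
  have := hK (S (S y) - (m ^+ 2)%:C *: y); rewrite XS => h1.
  have h2 : nrm y ^+ 2 <= K ^+ 2 * nrm (S (S y) - (m ^+ 2)%:C *: y) ^+ 2.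
    by rewrite -exprMn ler_sqr ?nnegrE ?mulr_ge0 ?nrm_ge0 // ltW.
  apply: le_trans h2 _; rewrite ler_pM2l ?exprn_gt0 //.
  rewrite (nrmX (S _ - _)) !rinE -!nrmX (rinC y) sS -nrmX.
  have : nrm (S (S y)) ^+ 2 <= m ^+ 2 * nrm (S y) ^+ 2.
    by rewrite -exprMn ler_sqr ?nnegrE ?mulr_ge0 ?nrm_ge0 //.
  lra.
apply: contrapT => /eqP x0; have nx := nrm_gt0 x0.
have mp : 0 < m.
  rewrite lt_neqAle m0 andbT; apply/eqP => em; have := hk x.
  rewrite -em expr0n mul0r mulr0 => h; have := exprn_gt0 2 nx; lra.
pose e := (K ^+ 2 * m ^+ 2)^-1.
have KM : 0 < K ^+ 2 * m ^+ 2 by rewrite mulr_gt0 // exprn_gt0.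
have e0 : 0 < e by rewrite invr_gt0.
have hS y : nrm (S y) ^+ 2 <= (m ^+ 2 - e) * nrm y ^+ 2.
  have := hk y; rewrite mulrA -ler_pdivrMl // -/e; lra.
have me : 0 <= m ^+ 2 - e.
  have := hS x; have := exprn_gt0 2 nx; have := sqr_ge0 (nrm (S x)) => h1 h2 h3.
  by rewrite -(pmulr_lge0 _ h2); lra.
have : m <= Num.sqrt (m ^+ 2 - e).
  apply: opnorm_le; rewrite ?sqrtr_ge0 // => y.
  by rewrite -ler_sqr ?nnegrE ?mulr_ge0 ?nrm_ge0 ?sqrtr_ge0 // exprMn sqr_sqrtr.
rewrite -ler_sqr ?nnegrE ?sqrtr_ge0 // sqr_sqrtr //; lra.
Qed.

Implicit Types f g h : {poly R}.

Lemma poly_opE f (T : H -> H) : poly_op f T = cpoly_op (map_poly (real_complex R) f) T.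
Proof.
apply/funext => x; rewrite /poly_op (@cpoly_op_widen (size f)) ?size_poly //.
by apply: eq_bigr => i _; rewrite coef_map.
Qed.

Lemma poly_op_bounded f T : bounded_op T -> bounded_op (poly_op f T).
Proof. by rewrite poly_opE; exact: cpoly_op_bounded. Qed.

Lemma poly_opD f g T x : poly_op (f + g) T x = poly_op f T x + poly_op g T x.
Proof. by rewrite !poly_opE rmorphD cpoly_opD. Qed.

Lemma poly_opC a T x : poly_op a%:P T x = a%:C *: x.
Proof. by rewrite poly_opE map_polyC cpoly_opC. Qed.

Lemma poly_opM f g T x : linear T ->
  poly_op (f * g) T x = poly_op f T (poly_op g T x).
Proof. by move=> lT; rewrite !poly_opE rmorphM cpoly_opM. Qed.

Lemma poly_opX T x : poly_op 'X T x = T x.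
Proof.
by rewrite poly_opE map_polyX -[X in cpoly_op X]mul1r cpoly_opMX cpoly_opC scale1r.
Qed.

Lemma poly_opN f T x : linear T -> poly_op (- f) T x = - poly_op f T x.
Proof.
by move=> lT; rewrite -mulN1r poly_opM // -polyCN poly_opC rmorphN scaleN1r.
Qed.

Lemma poly_opB f g T x : linear T ->
  poly_op (f - g) T x = poly_op f T x - poly_op g T x.
Proof. by move=> lT; rewrite poly_opD poly_opN. Qed.

Lemma poly_op_intertwine f (S T K : H -> H) : linear K ->
  (forall x, S (K x) = K (T x)) ->
  forall x, poly_op f S (K x) = K (poly_op f T x).
Proof. by move=> lK hK x; rewrite !poly_opE; exact: cpoly_op_intertwine. Qed.

Lemma poly_op_self_adjoint f T : self_adjoint T -> self_adjoint (poly_op f T).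
Proof.
move=> /self_adjointP[bT sT]; apply/self_adjointP; split; first exact: poly_op_bounded.
have lT := bT.1; elim/poly_ind: f => [|f a IHf] x y.
  by rewrite -(polyC0 R) !poly_opC !rinE !mul0r.
rewrite !poly_opD !poly_opM // !poly_opX !poly_opC !rinE IHf sT.
by rewrite (@poly_op_intertwine f T T T).
Qed.

(** Every nonzero polynomial g^2 - ||g(T)||^2 has a root in the spectrum, by
    [sqr_opnorm_spectrum] and [cpoly_op_spectrum].  Applied to g = X this shows that the
    spectrum is not empty, which settles the case where f is constant. *)
Lemma poly_op_nbound_spectrum f T c : self_adjoint T -> 0 <= c ->
  (forall t : R, spectrum T t%:C -> `|f.[t]| <= c) -> nbound (poly_op f T) c.
Proof.
move=> saT c0 hf; have [bT sT] := (self_adjointP T).1 saT; have lT := bT.1.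
have [H0|/existsNP[x0 x00]] := pselect (forall x : H, x = 0).
  by move=> x; rewrite (H0 (poly_op f T x)) nrm0 mulr_ge0 // nrm_ge0.
have key g : g ^+ 2 - (opnorm (poly_op g T) ^+ 2)%:P != 0 ->
    exists2 t : R, spectrum T t%:C & g.[t] ^+ 2 = opnorm (poly_op g T) ^+ 2.
  set m := opnorm _ => g0; set p := g ^+ 2 - _ in g0.
  have [||z rz sz] := @cpoly_op_spectrum (map_poly (real_complex R) p) T bT.
  - by rewrite map_poly_eq0.
  - rewrite -poly_opE => hi; apply: x00.
    apply: (@sqr_opnorm_spectrum (poly_op g T)); first exact: poly_op_self_adjoint.
    rewrite (_ : (fun x => _) = poly_op p T) //; apply/funext => x.
    by rewrite /p poly_opB // expr2 poly_opM // poly_opC.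
  have ez := spectrum_real saT sz; rewrite ez in sz rz *.
  exists (complex.Re z) => //; move: rz; rewrite /root horner_map.
  rewrite -(rmorph0 (real_complex R)) (inj_eq (@complexI R)) /p !hornerE.
  by rewrite subr_eq0 => /eqP.
have [t0 ht0] : exists t : R, spectrum T t%:C.
  have [|t ht _] := key 'X; last by exists t.
  by rewrite -size_poly_eq0 size_XnsubC.
have main : opnorm (poly_op f T) <= c.
  have hm := opnorm_ge0 (poly_op_bounded f bT).
  have [t ht et] : exists2 t : R, spectrum T t%:C & f.[t] ^+ 2 = opnorm (poly_op f T) ^+ 2.
    have [e|/key//] := eqVneq (f ^+ 2 - (opnorm (poly_op f T) ^+ 2)%:P) 0.
    exists t0 => //; have := congr1 (fun g : {poly R} => g.[t0]) e.
    by rewrite !hornerE => /eqP; rewrite subr_eq0 => /eqP.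
  apply: le_trans (hf t ht); rewrite -ler_sqr ?nnegrE // -et real_normK //.
  exact: num_real.
move=> x; apply: le_trans (opnorm_nbound (poly_op_bounded f bT) x) _.
exact: ler_wpM2r (nrm_ge0 _) _ _ main.
Qed.

Lemma poly_op_nbound f T a b c : self_adjoint T -> between T a b -> 0 <= c ->
  (forall t : R, a <= t <= b -> `|f.[t]| <= c) -> nbound (poly_op f T) c.
Proof.
move=> saT hT c0 hf; apply: poly_op_nbound_spectrum => // t.
by move=> /(spectrum_between saT hT)/hf.
Qed.
End HilbertSpace.

(** * Polynomial approximation of powers *)

Section Approximation.
Context {R : realType}.
Implicit Types (f : R -> R) (a b c e s t x : R).

Lemma invS_small e : 0 < e -> exists N, forall k, (N <= k)%N -> k.+1%:R^-1 <= e.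
Proof.
move=> e0; exists (Num.trunc e^-1) => k hk.
rewrite -[leRHS]invrK lef_pV2 ?posrE ?invr_gt0 // ?ltr0n //.
by apply: ltW; apply: lt_le_trans (truncnS_gt _) _; rewrite ler_nat ltnS.
Qed.

(** The N-th Bernstein polynomial, the expectation of g at a binomial variable of
    parameters N and x, by conditioning on the first trial. *)
Fixpoint bernstein N (g : nat -> R) : {poly R} :=
  if N is N'.+1 then 'X * bernstein N' (fun k => g k.+1) + (1 - 'X) * bernstein N' g
  else (g 0%N)%:P.

Lemma bernsteinS N (g : nat -> R) x :
  (bernstein N.+1 g).[x] = x * (bernstein N (fun k => g k.+1)).[x] + (1 - x) * (bernstein N g).[x].
Proof. by rewrite /= !hornerE. Qed.

Lemma bernstein_le N (g h : nat -> R) x : 0 <= x <= 1 ->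
  (forall k, (k <= N)%N -> g k <= h k) -> (bernstein N g).[x] <= (bernstein N h).[x].
Proof.
move=> /andP[x0 x1]; elim: N g h => [|N IHN] g h gh; first by rewrite !hornerE gh.
rewrite !bernsteinS lerD // ler_wpM2l ?subr_ge0 //; apply: IHN => k kN; apply: gh => //.
exact: leqW.
Qed.

Lemma bernstein_affine N (g : nat -> R) x a b :
  (bernstein N (fun k => a * g k + b)).[x] = a * (bernstein N g).[x] + b.
Proof.
elim: N g => [|N IHN] g; first by rewrite !hornerE.
have /= h := IHN (fun k => g k.+1); rewrite !bernsteinS h IHN; ring.
Qed.

Lemma bernstein_variance N x a :
  (bernstein N (fun k => (k%:R - a) ^+ 2)).[x] = (N%:R * x - a) ^+ 2 + N%:R * (x * (1 - x)).
Proof.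
elim: N a => [|N IHN] a; first by rewrite !hornerE; ring.
rewrite bernsteinS IHN.
have -> : (fun k : nat => (k.+1%:R - a) ^+ 2) = (fun k : nat => (k%:R - (a - 1)) ^+ 2) :> (nat -> R).
  by apply/funext => k; rewrite -natr1; ring.
by rewrite IHN -natr1; ring.
Qed.

(** By L d <= e/2 + (L d)^2/(2e), the error at x is at most e/2 plus a multiple of the
    variance of the binomial frequency, which is at most 1/N. *)
Lemma lipschitz_bernstein f L e : 0 <= L -> 0 < e ->
  (forall s t, 0 <= s <= 1 -> 0 <= t <= 1 -> `|f s - f t| <= L * `|s - t|) ->
  exists q : {poly R}, forall t, 0 <= t <= 1 -> `|q.[t] - f t| <= e.
Proof.
move=> L0 e0 hL.
pose N := (Num.trunc (L ^+ 2 / e ^+ 2)).+1.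
have e2 : 0 < e ^+ 2 by rewrite exprn_gt0.
have N0 : 0 < N%:R :> R by rewrite ltr0n.
have hN : L ^+ 2 <= e ^+ 2 * N%:R.
  rewrite mulrC -ler_pdivrMr //; apply: ltW; exact: truncnS_gt.
exists (bernstein N (fun k => f (k%:R / N%:R))) => x hx.
pose C := L ^+ 2 / (2 * e * N%:R ^+ 2).
have hk k : (k <= N)%N ->
    `|f (k%:R / N%:R) - f x| <= e / 2 + C * (k%:R - N%:R * x) ^+ 2.
  move=> kN; apply: le_trans (hL _ _ _ hx) _.
    by rewrite divr_ge0 ?ler0n // ler_pdivrMr // mul1r ler_nat.
  set d := `|_|.
  have -> : C * (k%:R - N%:R * x) ^+ 2 = (L * d) ^+ 2 / (2 * e).
    rewrite exprMn /d real_normK ?num_real // /C; field.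
    by rewrite !gt_eqF.
  have : 0 <= (L * d - e) ^+ 2 / (2 * e) by rewrite divr_ge0 ?sqr_ge0 //; lra.
  have -> : (L * d - e) ^+ 2 / (2 * e) = (L * d) ^+ 2 / (2 * e) + e / 2 - L * d.
    by field; rewrite gt_eqF.
  by rewrite subr_ge0 addrC.
have hv : C * (N%:R * (x * (1 - x))) <= e / 2.
  have xx : x * (1 - x) <= 1 by case/andP: hx => ? ?; nra.
  have C0 : 0 <= C by rewrite /C divr_ge0 ?sqr_ge0 // mulr_ge0 ?sqr_ge0 //; lra.
  have h1 : C * (N%:R * (x * (1 - x))) <= C * N%:R.
    by rewrite -[leRHS]mulr1 -mulrA !ler_wpM2l // ler0n.
  apply: le_trans h1 _.
  have -> : C * N%:R = L ^+ 2 / (2 * e * N%:R) by rewrite /C; field; rewrite !gt_eqF.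
  rewrite ler_pdivrMr; last by rewrite !mulr_gt0.
  by rewrite (_ : _ * (_ * _) = e ^+ 2 * N%:R) //; field.
have hb s : (bernstein N (fun k => s * ((k%:R - N%:R * x) ^+ 2) + 0)).[x]
    = s * (N%:R * (x * (1 - x))).
  by rewrite bernstein_affine bernstein_variance subrr expr0n /= add0r addr0.
rewrite ler_norml; apply/andP; split.
  have := @bernstein_le N (fun k => - C * (k%:R - N%:R * x) ^+ 2 + (f x - e / 2))
    (fun k => f (k%:R / N%:R)) x hx.
  rewrite bernstein_affine bernstein_variance subrr expr0n /= add0r => /(_ _) h.
  have {}h := h (fun k kN => ltac:(by have := hk k kN; rewrite ler_norml => /andP[]; lra)).
  lra.
have := @bernstein_le N (fun k => f (k%:R / N%:R))
  (fun k => C * (k%:R - N%:R * x) ^+ 2 + (f x + e / 2)) x hx.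
rewrite bernstein_affine bernstein_variance subrr expr0n /= add0r => h.
have {}h := h (fun k kN => ltac:(by have := hk k kN; rewrite ler_norml => /andP[]; lra)).
lra.
Qed.

Definition approximable a b f := forall e, 0 < e ->
  exists q : {poly R}, forall t, a <= t <= b -> `|q.[t] - f t| <= e.

Lemma lipschitz_approximable a b f L : a < b -> 0 <= L ->
  (forall s t, a <= s <= b -> a <= t <= b -> `|f s - f t| <= L * `|s - t|) ->
  approximable a b f.
Proof.
move=> ab L0 hL e e0; have d0 : 0 < b - a by rewrite subr_gt0.
have itv s : 0 <= s <= 1 -> a <= a + (b - a) * s <= b.
  by move=> /andP[s0 s1]; apply/andP; split; nra.
have [||s t hs ht|q hq] := @lipschitz_bernstein (fun s => f (a + (b - a) * s)) (L * (b - a)) e.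
- by rewrite mulr_ge0 // ltW.
- by [].
- apply: le_trans (hL _ _ (itv _ hs) (itv _ ht)) _.
  rewrite -mulrA ler_wpM2l // [_ - _](_ : _ = (b - a) * (s - t)); last ring.
  by rewrite normrM gtr0_norm.
exists (q \Po ((b - a)^-1 *: ('X - a%:P))) => t /andP[ta tb].
have hs : 0 <= (t - a) / (b - a) <= 1.
  apply/andP; split; first by apply: divr_ge0; [rewrite subr_ge0 | exact: ltW].
  by rewrite ler_pdivrMr // mul1r lerB.
have := hq _ hs; have -> : a + (b - a) * ((t - a) / (b - a)) = t by field; rewrite gt_eqF.
rewrite horner_comp (_ : (_ *: _).[t] = (t - a) / (b - a)) //.
by rewrite !hornerE mulrC.
Qed.

(** From 1 + u <= exp u, with u = s - t. *)
Lemma expR_lipschitz s t c : s <= c -> t <= c ->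
  `|expR s - expR t| <= expR c * `|s - t|.
Proof.
wlog st : s t / s <= t.
  move=> hw sc tc; case/orP: (le_total s t) => h; first exact: hw.
  by rewrite distrC (distrC s); apply: hw.
move=> sc tc; rewrite distrC (distrC s) !ger0_norm ?subr_ge0 ?ler_expR //.
have h1 : expR t - expR s <= expR t * (t - s).
  have := expR_ge1Dx (s - t); rewrite -(ler_pM2l (expR_gt0 t)) -expRD.
  by rewrite subrKC; lra.
apply: le_trans h1 _; rewrite ler_wpM2r ?subr_ge0 // ler_expR //.
Qed.

Lemma powR_expR s t : 0 < t -> t `^ s = expR (s * ln t).
Proof. by move=> t0; rewrite /powR gt_eqF. Qed.

Lemma ln_bound a b t : 0 < a -> a <= t <= b -> `|ln t| <= `|ln a| + `|ln b|.
Proof.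
move=> a0 /andP[at_ tb]; have t0 : 0 < t by exact: lt_le_trans at_.
have b0 : 0 < b by exact: lt_le_trans tb.
have h1 : ln a <= ln t by rewrite ler_ln.
have h2 : ln t <= ln b by rewrite ler_ln.
have := ler_norm (ln b); have := normr_ge0 (ln b); have := normr_ge0 (ln a).
have := ler_norm (- ln a); rewrite normrN => *; rewrite ler_norml; lra.
Qed.

Lemma ln_lipschitz a s t : 0 < a -> a <= s -> a <= t ->
  `|ln s - ln t| <= a^-1 * `|s - t|.
Proof.
move=> a0; wlog st : s t / s <= t.
  move=> hw sc tc; case/orP: (le_total s t) => h; first exact: hw.
  by rewrite distrC (distrC s); apply: hw.
move=> ha _; have s0 : 0 < s by exact: lt_le_trans ha.
have t0 : 0 < t by exact: lt_le_trans st.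
rewrite distrC (distrC s) !ger0_norm ?subr_ge0 ?ler_ln //.
rewrite -ln_div // [leRHS]mulrC.
have := expR_ge1Dx (ln (t / s)); rewrite lnK ?posrE ?divr_gt0 // => h.
have : (t - s) / s <= (t - s) / a.
  by rewrite ler_wpM2l ?subr_ge0 // lef_pV2 ?posrE.
have -> : (t - s) / s = t / s - 1 by field; rewrite gt_eqF.
lra.
Qed.

(** On [a, b] with a > 0 the function t^s = exp (s ln t) is Lipschitz. *)
Lemma powR_approximable a b s : 0 < a < b -> approximable a b (fun t => t `^ s).
Proof.
move=> /andP[a0 ab]; set K := `|s| * (`|ln a| + `|ln b|).
apply: (@lipschitz_approximable _ _ _ (expR K * (`|s| * a^-1))) => //.
  by rewrite mulr_ge0 ?expR_ge0 // mulr_ge0 // invr_ge0 ltW.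
have hK t : a <= t <= b -> s * ln t <= K.
  move=> ht; apply: le_trans (ler_norm _) _; rewrite normrM /K ler_wpM2l //.
  exact: ln_bound.
move=> u v hu hv; have [/andP[au _] /andP[av _]] := (hu, hv).
rewrite !powR_expR ?(lt_le_trans a0) //.
apply: le_trans (expR_lipschitz (hK _ hu) (hK _ hv)) _.
rewrite -mulrBr normrM -!mulrA ler_wpM2l ?expR_ge0 // ler_wpM2l //.
exact: ln_lipschitz.
Qed.

Lemma powR_exponent_continuous a b s : 0 < a -> exists2 L, 0 <= L &
  forall u t, 0 <= u <= 1 -> 0 <= s <= 1 -> a <= t <= b -> `|t `^ u - t `^ s| <= L * `|u - s|.
Proof.
move=> a0; set K := `|ln a| + `|ln b|; have K0 : 0 <= K by rewrite addr_ge0.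
exists (expR K * K) => [|u t hu hs ht]; first by rewrite mulr_ge0 ?expR_ge0.
have lt := ln_bound a0 ht; case/andP: (ht) => at_ _.
have hK v : 0 <= v <= 1 -> v * ln t <= K.
  move=> /andP[v0 v1]; apply: le_trans lt; apply: le_trans (ler_norm _) _.
  by rewrite normrM ger0_norm // ler_piMl.
rewrite !powR_expR ?(lt_le_trans a0) //.
apply: le_trans (expR_lipschitz (hK _ hu) (hK _ hs)) _.
by rewrite -mulrBl normrM -mulrA ler_wpM2l ?expR_ge0 // mulrC ler_wpM2r.
Qed.

Lemma uniform_seqP (D : set R) (u : nat -> R -> R) f :
  {uniform D, u @ \oo --> f} <->
  forall e, 0 < e -> exists N, forall n, (N <= n)%N -> forall t, D t -> `|u n t - f t| <= e.
Proof.
split=> [h e e0|h P /uniform_nbhs[E [entE EP]]].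
  have [|N _ hN] := h [set g | forall t, D t -> `|f t - g t| < e].
    apply/uniform_nbhs; exists [set xy | ball xy.1 e xy.2]; split=> //.
    by rewrite -entourage_ballE; exists e.
  by exists N => n Nn t Dt; rewrite distrC ltW //; exact: hN.
move: entE; rewrite -entourage_ballE => -[e /= e0 he].
have [N hN] := h (e / 2) ltac:(by rewrite divr_gt0).
exists N => // n Nn; apply: EP => t Dt; apply: he => /=.
rewrite /ball /= distrC; apply: le_lt_trans (hN n Nn t Dt) _; lra.
Qed.
End Approximation.

(** * Functional calculus on an interval *)

Section Calculus.
Context {R : realType} {H : hilbertType R}.
Implicit Types (x y z : H) (S T K X Y Z : H -> H) (a b c d e s t : R) (f g : R -> R)
  (q r : {poly R}).

Lemma nbound_trans S T K c d : nbound (fun x => S x - T x) c ->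
  nbound (fun x => T x - K x) d -> nbound (fun x => S x - K x) (c + d).
Proof.
move=> h1 h2 x; rewrite mulrDl.
rewrite (_ : S x - K x = (S x - T x) + (T x - K x)); last by rewrite addrA subrK.
exact: le_trans (nrmD _ _) (lerD (h1 x) (h2 x)).
Qed.

Lemma nbound_sym S T c : nbound (fun x => S x - T x) c -> nbound (fun x => T x - S x) c.
Proof. by move=> h x; rewrite nrmB_sym. Qed.

Lemma nbound_closed T c : (forall e, 0 < e -> nbound T (c + e)) -> nbound T c.
Proof.
move=> h x; have [x0|x0] := eqVneq (nrm x) 0.
  by have := h 1 ltr01 x; rewrite x0 !mulr0.
have nx : 0 < nrm x by rewrite lt_neqAle eq_sym x0 nrm_ge0.
apply/ler_addgt0Pl => e e0; have := h (e / nrm x) (divr_gt0 e0 nx) x.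
by rewrite mulrDl divfK // addrC.
Qed.

Lemma nbound0 T x : nbound T 0 -> T x = 0.
Proof.
move=> /(_ x); rewrite mul0r => h; apply: nrm_eq0.
by apply/eqP; rewrite eq_le h nrm_ge0.
Qed.

Lemma nbound_le T c d : c <= d -> nbound T c -> nbound T d.
Proof. by move=> cd h x; apply: le_trans (h x) _; apply: ler_wpM2r; rewrite ?nrm_ge0. Qed.

(** X is f(T) for an f approximated on an interval containing the numerical range.  An
    interval is easier to transport than the spectrum: it can be shared by two operators
    ([calc_intertwine]) or be the image of another interval ([calc_comp]). *)
Definition calc T a b f X := bounded_op X /\
  forall e, 0 < e -> exists2 q, (forall t, a <= t <= b -> `|q.[t] - f t| <= e) &
    nbound (fun x => poly_op q T x - X x) e.

(** Polynomials close to f on the interval are close to each other at T, so X may be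
    compared with any of them, in particular with one shared by another operator. *)
Lemma calc_dist T a b f X q e : self_adjoint T -> between T a b -> 0 <= e ->
  calc T a b f X -> (forall t, a <= t <= b -> `|q.[t] - f t| <= e) ->
  nbound (fun x => poly_op q T x - X x) e.
Proof.
move=> saT hT e0 [bX hX] hq; apply: nbound_closed => d d0.
have [r hr hrX] := hX (d / 2) ltac:(lra).
have -> : e + d = (e + d / 2) + d / 2 by lra.
apply: nbound_trans hrX => x.
rewrite -poly_opB; last exact: saT.1.1.
apply: (@poly_op_nbound _ _ (q - r) T a b (e + d / 2)) => //; first lra.
move=> t ht; rewrite !hornerE (_ : _ - _ = (q.[t] - f t) - (r.[t] - f t)); last ring.
by apply: le_trans (ler_normB _ _) _; apply: lerD; [exact: hq|exact: hr].
Qed.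

Lemma calc_exists T a b f : self_adjoint T -> between T a b ->
  approximable a b f -> exists X, calc T a b f X.
Proof.
move=> saT hT hf; have bT := saT.1.
have inv0 (k : nat) : 0 < k.+1%:R^-1 :> R by rewrite invr_gt0 ltr0n.
have hfk k : exists q : {poly R}, forall t, a <= t <= b -> `|q.[t] - f t| <= k.+1%:R^-1.
  exact: hf.
have [q hq] := choice hfk.
have inv_small := @invS_small R.
have dist m n : nbound (fun x => poly_op (q m) T x - poly_op (q n) T x)
    (m.+1%:R^-1 + n.+1%:R^-1).
  move=> x; rewrite -poly_opB; last exact: bT.1.
  apply: (@poly_op_nbound _ _ (q m - q n) T a b) => //.
  move=> t ht; rewrite !hornerE (_ : _ - _ = ((q m).[t] - f t) - ((q n).[t] - f t)); last ring.
  by apply: le_trans (ler_normB _ _) _; apply: lerD; exact: hq.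
have lim x : exists l, forall e, 0 < e -> exists N, forall n, (N <= n)%N ->
    nrm (poly_op (q n) T x - l) <= e.
  apply: nrm_cauchy => e e0.
  have d0 : 0 < nrm x + 1 by rewrite ltr_wpDl ?nrm_ge0.
  have [N hN] := inv_small (e / (nrm x + 1) / 2) ltac:(by rewrite !divr_gt0).
  exists N => m n Nm Nn; apply: le_trans (dist m n x) _.
  have h1 := hN m Nm; have h2 := hN n Nn.
  have h3 : m.+1%:R^-1 + n.+1%:R^-1 <= e / (nrm x + 1) by rewrite [leRHS]splitr lerD.
  apply: le_trans (ler_wpM2r (nrm_ge0 x) h3) _.
  by rewrite mulrAC ler_pdivrMr // ler_pM2l // lerDl.
have [X hX] := choice lim.
have hqX k : nbound (fun x => poly_op (q k) T x - X x) k.+1%:R^-1.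
  move=> x; apply/ler_addgt0Pl => e e0.
  have d0 : 0 < nrm x + 1 by rewrite ltr_wpDl ?nrm_ge0.
  have [N hN] := inv_small (e / 2 / (nrm x + 1)) ltac:(by rewrite !divr_gt0).
  have [N' hN'] := hX x (e / 2) ltac:(by rewrite divr_gt0).
  pose n := maxn N N'.
  have h1 := hN n (leq_maxl _ _); have h2 := hN' n (leq_maxr _ _).
  rewrite (_ : poly_op (q k) T x - X x = (poly_op (q k) T x - poly_op (q n) T x)
     + (poly_op (q n) T x - X x)); last by rewrite addrA subrK.
  apply: le_trans (nrmD _ _) _.
  have h3 := dist k n x; rewrite mulrDl in h3.
  have h4 : n.+1%:R^-1 * nrm x <= e / 2.
    apply: le_trans (ler_wpM2r (nrm_ge0 x) h1) _.
    by rewrite mulrAC ler_pdivrMr // ler_pM2l ?lerDl // divr_gt0.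
  apply: le_trans (lerD h3 h2) _.
  by rewrite -addrA [leRHS]addrC lerD2l [leRHS]splitr lerD2r.
exists X; split; last first.
  move=> e /inv_small[N hN]; exists (q N) => [t ht|x].
    exact: le_trans (hq N t ht) (hN _ (leqnn _)).
  apply: le_trans (hqX N x) _; apply: ler_wpM2r; rewrite ?nrm_ge0 //; exact: hN.
apply/bounded_opP; split; last first.
  have /bounded_opP[_ [c c0 hc]] := poly_op_bounded (q 0%N) bT.
  exists (c + 1) => [|x]; first by rewrite addr_gt0.
  rewrite -[X x](subKr (poly_op (q 0%N) T x)).
  apply: le_trans (nrmD _ _) _; rewrite mulrDl nrmN lerD //.
  by have := hqX 0%N x; rewrite invr1.
move=> k x y; apply/eqP; rewrite -subr_eq0; apply/eqP/nrm_eq0.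
apply/eqP; rewrite eq_le nrm_ge0 andbT; apply/ler_addgt0Pl => e e0; rewrite addr0.
pose C := nrm (k *: x + y) + complex.Re `|k| * nrm x + nrm y + 1.
have k0 : 0 <= complex.Re `|k| by rewrite normc_def sqrtr_ge0.
have C0 : 0 < C by rewrite ltr_wpDl // !addr_ge0 ?mulr_ge0 ?nrm_ge0.
have [d d0 ed] : exists2 d, 0 < d & e = d * C.
  by exists (e / C); [exact: divr_gt0|rewrite divfK // gt_eqF].
have [N hN] := inv_small d d0.
have {}hN := hN N (leqnn _).
set Q := poly_op (q N) T.
have lQ : linear Q by have [] := poly_op_bounded (q N) bT.
have h x' : nrm (Q x' - X x') <= d * nrm x'.
  apply: le_trans (hqX N x') _; apply: ler_wpM2r; rewrite ?nrm_ge0 //.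
rewrite (_ : X (k *: x + y) - _ = - (Q (k *: x + y) - X (k *: x + y))
   + (k *: (Q x - X x) + (Q y - X y))); last first.
  rewrite lQ scalerBr opprB [_ - _ + (Q y - _)]addrACA subrKA opprD.
  by [].
apply: le_trans (nrmD _ _) _; rewrite nrmN.
apply: le_trans (lerD (h _) (nrmD _ _)) _; rewrite nrmZc.
have h1 := h y; have h2 := ler_wpM2l k0 (h x).
rewrite ed /C; lra.
Qed.

Lemma calc_unique T a b f X Y : self_adjoint T -> between T a b ->
  calc T a b f X -> calc T a b f Y -> X = Y.
Proof.
move=> saT hT hX hY; apply/funext => x; apply/eqP; rewrite -subr_eq0; apply/eqP.
apply: (@nbound0 (fun x => X x - Y x)); apply: nbound_closed => e e0; rewrite add0r.
have [q hq hqY] := hY.2 (e / 2) ltac:(by rewrite divr_gt0).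
have -> : e = e / 2 + e / 2 by lra.
apply: nbound_trans hqY; apply: nbound_sym.
by apply: (calc_dist _ _ _ hX hq) => //; rewrite divr_ge0 // ltW.
Qed.

(** The spectrum lies in the interval, so X is an admissible value; and polynomials
    close to f merely on the spectrum already converge to X, so it is the only one. *)
Lemma calc_fun_calculus T a b f X : self_adjoint T -> between T a b ->
  calc T a b f X -> fun_calculus T f = X.
Proof.
move=> saT hT hX; have bT := saT.1; apply: xget_unique.
  split; first exact: hX.1.
  have inv0 (k : nat) : 0 < k.+1%:R^-1 :> R by rewrite invr_gt0 ltr0n.
  have inv_small := @invS_small R.
  have hX2 k : exists q, (forall t, a <= t <= b -> `|q.[t] - f t| <= k.+1%:R^-1) /\
      nbound (fun x => poly_op q T x - X x) k.+1%:R^-1.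
    by have [q] := hX.2 _ (inv0 k); exists q.
  have [q hq] := choice hX2; exists q; split.
    apply/uniform_seqP => e /inv_small[N hN]; exists N => n Nn t ht.
    exact: le_trans ((hq n).1 t (spectrum_between saT hT ht)) (hN n Nn).
  have bq n : bounded_op (poly_op (q n) T \- X).
    by apply: bounded_sub; [exact: poly_op_bounded|exact: hX.1].
  apply/cvgrPdist_le => e /inv_small[N hN]; exists N => // n Nn /=.
  rewrite sub0r normrN ger0_norm ?opnorm_ge0 //.
  apply: opnorm_le => //; first exact: ltW (lt_le_trans (inv0 n) (hN n Nn)).
  exact: nbound_le (hN n Nn) (hq n).2.
move=> Y [bY [q [/uniform_seqP hq hqY]]].
apply/funext => x; apply/eqP; rewrite -subr_eq0; apply/eqP.
apply: (@nbound0 (fun x => Y x - X x)); apply: nbound_closed => e e0; rewrite add0r.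
have e4 : 0 < e / 4 by rewrite divr_gt0.
have [N1 hN1] := hq _ e4.
have [N2 _ hN2] := (cvgrPdist_le _ _).1 hqY _ e4.
pose n := maxn N1 N2.
have h1 := hN1 n (leq_maxl _ _); have h2 := hN2 n (leq_maxr _ _).
have bqY : bounded_op (poly_op (q n) T \- Y) by apply: bounded_sub; [exact: poly_op_bounded|].
rewrite /= sub0r normrN ger0_norm ?opnorm_ge0 // in h2.
have {}h2 : nbound (fun x => poly_op (q n) T x - Y x) (e / 4).
  exact: nbound_le h2 (opnorm_nbound bqY).
have [r hr hrX] := hX.2 _ e4.
have -> : e = e / 4 + e / 2 + e / 4 by lra.
apply: nbound_trans hrX; apply: nbound_trans (nbound_sym h2) _ => {}x.
rewrite -poly_opB; last exact: bT.1.
apply: (@poly_op_nbound_spectrum _ _ (q n - r) T (e / 2)) => //; first lra.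
move=> t ht; rewrite !hornerE (_ : _ - _ = ((q n).[t] - f t) - (r.[t] - f t)); last ring.
have -> : e / 2 = e / 4 + e / 4 by lra.
apply: le_trans (ler_normB _ _) _; apply: lerD; first exact: h1.
by apply: hr; exact: (spectrum_between saT hT ht).
Qed.

Lemma calc_poly T a b q : bounded_op T -> calc T a b (fun t => q.[t]) (poly_op q T).
Proof.
move=> bT; split; first exact: poly_op_bounded.
move=> e e0; exists q => [t _|x]; first by rewrite subrr normr0 ltW.
by rewrite subrr nrm0 mulr_ge0 ?nrm_ge0 // ltW.
Qed.

Lemma calc_ext T a b f g X : (forall t, a <= t <= b -> f t = g t) ->
  calc T a b f X -> calc T a b g X.
Proof.
move=> fg [bX hX]; split=> // e /hX[q hq ?]; exists q => // t ht.
by rewrite -fg //; exact: hq.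
Qed.

Lemma calc_add T a b f g X Y : calc T a b f X -> calc T a b g Y ->
  calc T a b (fun t => f t + g t) (fun x => X x + Y x).
Proof.
move=> [bX hX] [bY hY]; split; first exact: bounded_add.
move=> e e0; have e2 : 0 < e / 2 by rewrite divr_gt0.
have [q hq hqX] := hX _ e2; have [r hr hrY] := hY _ e2.
exists (q + r) => [t ht|x]; rewrite (splitr e).
  rewrite hornerD opprD addrACA; apply: le_trans (ler_normD _ _) _.
  by apply: lerD; [exact: hq|exact: hr].
rewrite poly_opD opprD addrACA mulrDl; apply: le_trans (nrmD _ _) _.
by apply: lerD; [exact: hqX|exact: hrY].
Qed.

Lemma calc_nbound T a b f X c : self_adjoint T -> between T a b ->
  calc T a b f X -> 0 <= c -> (forall t, a <= t <= b -> `|f t| <= c) -> nbound X c.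
Proof.
move=> saT hT [bX hX] c0 hc; apply: nbound_closed => e e0.
have [q hq hqX] := hX (e / 2) ltac:(by rewrite divr_gt0).
have hqc : nbound (poly_op q T) (c + e / 2).
  apply: (@poly_op_nbound _ _ q T a b) => //; first lra.
  move=> t ht; rewrite -[q.[t]](subrK (f t)) addrC.
  by apply: le_trans (ler_normD _ _) _; apply: lerD; [exact: hc|exact: hq].
move=> x; rewrite (_ : X x = poly_op q T x - (poly_op q T x - X x)); last by rewrite subKr.
apply: le_trans (nrmD _ _) _; rewrite nrmN.
by have := hqc x; have := hqX x; rewrite !mulrDl; lra.
Qed.

Lemma calc_self_adjoint T a b f X : self_adjoint T -> calc T a b f X -> self_adjoint X.
Proof.
move=> saT [bX hX]; apply/self_adjointP; split=> // x y.
apply/eqP; rewrite -subr_eq0 -normr_le0; apply/ler_addgt0Pl => e e0; rewrite addr0.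
pose C := 2 * (nrm x * nrm y) + 1.
have C0 : 0 < C by rewrite ltr_wpDl // mulr_ge0 // mulr_ge0 ?nrm_ge0.
have [q _ hq] := hX (e / C) (divr_gt0 e0 C0).
have /self_adjointP[_ sq] := poly_op_self_adjoint q saT.
have h1 : `|rin (poly_op q T x - X x) y| <= e / C * (nrm x * nrm y).
  rewrite ler_norml; have h := hq x.
  have := cauchy_schwarz (poly_op q T x - X x) y.
  have := cauchy_schwarz (- (poly_op q T x - X x)) y; rewrite nrmN rinNl.
  have := ler_wpM2r (nrm_ge0 y) h; lra.
have h2 : `|rin x (poly_op q T y - X y)| <= e / C * (nrm x * nrm y).
  rewrite ler_norml; have h := hq y.
  have := cauchy_schwarz x (poly_op q T y - X y).
  have := cauchy_schwarz (- x) (poly_op q T y - X y); rewrite nrmN rinNl.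
  have := ler_wpM2l (nrm_ge0 x) h; lra.
rewrite (_ : rin (X x) y - _ = rin x (poly_op q T y - X y) - rin (poly_op q T x - X x) y).
  apply: le_trans (ler_normB _ _) _; apply: le_trans (lerD h2 h1) _.
  have : e = e / C * C by rewrite divfK // gt_eqF.
  rewrite {2}/C => {3}->; have : 0 < e / C by rewrite divr_gt0.
  lra.
by rewrite !rinE sq; ring.
Qed.

Lemma poly_bounded q c : exists2 B, 0 <= B & forall t, `|t| <= c -> `|q.[t]| <= B.
Proof.
elim/poly_ind: q => [|q k [B B0 hB]]; first by exists 0 => // t _; rewrite horner0 normr0.
exists (B * `|c| + `|k|) => [|t ht]; first by rewrite addr_ge0 ?mulr_ge0.
rewrite !hornerE; apply: le_trans (ler_normD _ _) _; rewrite lerD // normrM.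
by apply: ler_pM; rewrite ?hB //; apply: le_trans ht (ler_norm _).
Qed.

Lemma itv_norm a b t : a <= t <= b -> `|t| <= `|a| + `|b|.
Proof.
move=> /andP[h1 h2]; have := ler_norm b; have := ler_norm (- a).
have := normr_ge0 a; have := normr_ge0 b.
rewrite normrN ler_norml; lra.
Qed.

Lemma calc_bounded T a b f X : calc T a b f X ->
  exists2 B, 0 <= B & forall t, a <= t <= b -> `|f t| <= B.
Proof.
move=> [_ /(_ 1 ltr01)[q hq _]]; have [B B0 hB] := poly_bounded q (`|a| + `|b|).
exists (B + 1) => [|t ht]; first by rewrite addr_ge0.
rewrite (_ : f t = q.[t] - (q.[t] - f t)); last by rewrite subKr.
apply: le_trans (ler_normB _ _) _; rewrite lerD ?hq //; exact: hB (itv_norm ht).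
Qed.

(** q r - f g = (q - f) r + f (r - g), both for functions and for operators. *)
Lemma calc_mul T a b f g X Y : self_adjoint T -> between T a b ->
  calc T a b f X -> calc T a b g Y ->
  calc T a b (fun t => f t * g t) (X \o Y).
Proof.
move=> saT hT hX hY; have bT := saT.1.
have [c c0 hc] := calc_bounded hX; have [d d0 hd] := calc_bounded hY.
split; first exact: bounded_comp hX.1 hY.1.
move=> e e0; pose D := e + c + d + 1; have D0 : 0 < D by rewrite ltr_wpDl // !addr_ge0 // ltW.
(* dl <= 1 and dl (d + 1 + c) <= e. *)
pose dl := e / D; have dl0 : 0 < dl by rewrite divr_gt0.
have dl1 : dl <= 1 by rewrite ler_pdivrMr // mul1r /D; lra.
have hdl : dl * (d + dl) + c * dl <= e.
  have : dl * D = e by rewrite divfK // gt_eqF.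
  rewrite /D; have := ler_wpM2l (ltW dl0) dl1; have := mulr_gt0 dl0 e0; lra.
have [q hq hqX] := hX.2 _ dl0; have [r hr hrY] := hY.2 _ dl0.
have hrb : nbound (poly_op r T) (d + dl).
  apply: (@poly_op_nbound _ _ r T a b) => //; first by rewrite addr_ge0 // ltW.
  move=> t ht; rewrite -[r.[t]](subrK (g t)) addrC.
  by apply: le_trans (ler_normD _ _) _; apply: lerD; [exact: hd|exact: hr].
have hXb := calc_nbound saT hT hX c0 hc.
exists (q * r) => [t ht|x].
  rewrite hornerM (_ : _ - _ = (q.[t] - f t) * r.[t] + f t * (r.[t] - g t)); last ring.
  apply: le_trans (ler_normD _ _) _; rewrite !normrM; apply: le_trans hdl.
  have hrt : `|r.[t]| <= d + dl.
    rewrite -[r.[t]](subrK (g t)) addrC.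
    by apply: le_trans (ler_normD _ _) _; apply: lerD; [exact: hd|exact: hr].
  by apply: lerD; apply: ler_pM; rewrite ?hq ?hc ?hr.
rewrite poly_opM; last exact: bT.1.
rewrite (_ : _ - _ = (poly_op q T (poly_op r T x) - X (poly_op r T x))
   + X (poly_op r T x - Y x)); last by rewrite (linB hX.1.1) addrA subrK.
apply: le_trans (nrmD _ _) _; apply: le_trans (ler_wpM2r (nrm_ge0 x) hdl).
rewrite mulrDl; apply: lerD; rewrite -mulrA.
  by apply: le_trans (hqX _) _; rewrite ler_wpM2l // ltW.
by apply: le_trans (hXb _) _; rewrite ler_wpM2l.
Qed.

(** f stays within (M-m)/2 of the midpoint (m+M)/2, hence so does X in norm. *)
Lemma calc_between T a b f X m M : self_adjoint T -> between T a b ->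
  calc T a b f X -> m <= M -> (forall t, a <= t <= b -> m <= f t <= M) -> between X m M.
Proof.
move=> saT hT hX mM hf x.
have h := calc_add hX (@calc_poly T a b (- ((m + M) / 2))%:P saT.1).
have {}h : nbound (fun x => X x + poly_op (- ((m + M) / 2))%:P T x) ((M - m) / 2).
  apply: (calc_nbound saT hT h); first lra.
  by move=> t /hf ft; rewrite hornerC ler_norml; lra.
have {}h := h x; rewrite poly_opC in h.
have {h} : nrm (X x + (- ((m + M) / 2))%:C *: x) * nrm x <= (M - m) / 2 * nrm x ^+ 2.
  by rewrite expr2 mulrA ler_wpM2r ?nrm_ge0.
have := cauchy_schwarz (X x + (- ((m + M) / 2))%:C *: x) x.
have := cauchy_schwarz (- (X x + (- ((m + M) / 2))%:C *: x)) x.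
rewrite nrmN !rinE -!nrmX; lra.
Qed.

(** The same polynomial q approximates f(S) and f(T), and q(S) K = K q(T). *)
Lemma calc_intertwine S T K a b f X Y :
  self_adjoint S -> between S a b -> self_adjoint T -> between T a b ->
  bounded_op K -> (forall x, S (K x) = K (T x)) ->
  calc S a b f X -> calc T a b f Y -> forall x, X (K x) = K (Y x).
Proof.
move=> saS hS saT hT /bounded_opP[lK [c c0 hc]] hK hX hY x.
apply/eqP; rewrite -subr_eq0; apply/eqP.
apply: (@nbound0 (fun x => X (K x) - K (Y x))).
apply: nbound_closed => e e0 {}x; rewrite add0r.
pose d := e / c / 2; have d0 : 0 < d by rewrite !divr_gt0.
have [q hq hqY] := hY.2 _ d0.
have hqX := calc_dist saS hS (ltW d0) hX hq.
have hi := poly_op_intertwine q lK hK x.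
rewrite (_ : X (K x) - _ = K (poly_op q T x - Y x) - (poly_op q S (K x) - X (K x))).
  apply: le_trans (nrmD _ _) _; rewrite nrmN.
  have h1 := le_trans (hc _) (ler_wpM2l (ltW c0) (hqY x)).
  have h2 := le_trans (hqX (K x)) (ler_wpM2l (ltW d0) (hc x)).
  apply: le_trans (lerD h1 h2) _; rewrite mulrA [d * _]mulrA -mulrDl.
  have -> : c * d + d * c = e by rewrite /d; field; exact: lt0r_neq0.
  by [].
by rewrite (linB lK) hi opprB [RHS]addrC subrKA.
Qed.

(** Polynomials of X = f(T) are values of the calculus of T, by [calc_mul]. *)
Lemma calc_comp T a b a' b' f g X Y : self_adjoint T -> between T a b ->
  calc T a b f X -> (forall t, a <= t <= b -> a' <= f t <= b') ->
  calc X a' b' g Y -> calc T a b (fun t => g (f t)) Y.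
Proof.
move=> saT hT hX hf hY; have bT := saT.1; split; first exact: hY.1.
have hpoly q : calc T a b (fun t => q.[f t]) (poly_op q X).
  elim/poly_ind: q => [|q k IHq].
    rewrite (_ : poly_op 0 X = poly_op 0%:P T); last first.
      by apply/funext => x; rewrite -(polyC0 R) !poly_opC.
    by apply: calc_ext (calc_poly a b _ bT) => t _; rewrite hornerC horner0.
  rewrite (_ : poly_op _ X = fun x => (poly_op q X \o X) x + poly_op k%:P T x).
    apply: calc_ext (calc_add (calc_mul saT hT IHq hX) (calc_poly a b k%:P bT)) => t _.
    by rewrite !hornerE.
  apply/funext => x; rewrite poly_opD poly_opM; last exact: hX.1.1.
  by rewrite poly_opX !poly_opC.
move=> e e0; have e2 : 0 < e / 2 by rewrite divr_gt0.
have [q hq hqY] := hY.2 _ e2; have [r hr hrX] := (hpoly q).2 _ e2.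
exists r; last by rewrite (splitr e); exact: nbound_trans hrX hqY.
move=> t ht; rewrite (splitr e) (_ : _ - _ = (r.[t] - q.[f t]) + (q.[f t] - g (f t))); last ring.
apply: le_trans (ler_normD _ _) _; apply: lerD; first exact: hr.
by apply: hq; exact: hf.
Qed.
End Calculus.

(** * Real powers of positive definite operators *)

Section Powers.
Context {R : realType} {H : hilbertType R}.
Implicit Types (x y z : H) (S T K X Y Z A B : H -> H) (a b c d e p r s t : R).

Lemma op_leE Y X : op_le Y X <-> [/\ self_adjoint X, self_adjoint Y & ople Y X].
Proof.
split=> [[saX saY [_ h]]|[saX saY h]]; split=> //.
  by move=> x; have := h x; rewrite lecE /= => /andP[_]; rewrite -/(rin _ _) rinDl rinNl subr_ge0.
split; first exact: bounded_sub saX.1 saY.1.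
move=> x; rewrite linearBl /= !self_adjoint_real // -rmorphB lecR subr_ge0; exact: h.
Qed.

(** Polarisation: the form of T is real at x + y as well, so (u, v) |-> Re <T (i u), v>
    is antisymmetric. *)
Lemma positive_self_adjoint T : positive_op T -> self_adjoint T.
Proof.
move=> [bT h]; apply/self_adjointP; split=> // x y; have lT := bT.1.
have hi z : rin (T ('i%C *: z)) z = 0.
  rewrite (linZ lT) /rin innerZi mulrC ReiNIm.
  by have := h z; rewrite lecE /= => /andP[/eqP ->]; rewrite oppr0.
have hp u v : rin (T ('i%C *: u)) v = - rin (T ('i%C *: v)) u.
  have := hi (u + v); rewrite scalerDr (linD lT) !rinE !hi; lra.
pose u := - 'i%C *: x; have ux : 'i%C *: u = x.
  by rewrite /u scalerA mulrN -expr2 sqr_i opprK scale1r.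
rewrite -{1}ux hp (linZ lT) -rinZi ux scalerA -expr2 sqr_i scaleN1r rinNl opprK.
exact: rinC.
Qed.

(** An explicit interval for a positive definite operator; a < b, rather than a <= b,
    leaves room to rescale to the unit interval. *)
Definition pd_on T a b := [/\ self_adjoint T, 0 < a, a < b & between T a b].

Lemma pd_intro T : self_adjoint T -> (forall x, 0 <= rin (T x) x) -> op_invertible T ->
  positive_definite T.
Proof.
move=> saT h iT; split=> //; split; first exact: saT.1.
by move=> x; rewrite self_adjoint_real // lecR.
Qed.

Lemma positive_definiteP T : positive_definite T <-> exists a b, pd_on T a b.
Proof.
split=> [[pT [X [bX XT _]]]|[a [b [saT a0 ab hT]]]]; last first.
  apply: pd_intro => //; last first.
    by apply: (coercive_invertible saT.1 a0) => x; have /andP[] := hT x.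
  move=> x; have /andP[h _] := hT x; apply: le_trans h.
  by rewrite mulr_ge0 ?sqr_ge0 // ltW.
have saT := positive_self_adjoint pT; have /self_adjointP[_ sT] := saT.
have /bounded_opP[_ [K K0 hK]] := bX.
have /bounded_opP[lT [M M0 hM]] := saT.1.
have T0 x : 0 <= rin (T x) x by have := pT.2 x; rewrite self_adjoint_real // lecR.
have upper x : rin (T x) x <= M * nrm x ^+ 2.
  by apply: le_trans (cauchy_schwarz _ _) _; rewrite expr2 mulrA ler_wpM2r ?nrm_ge0.
(* The form of T is nonnegative at x - t (T x) for t = 1/M. *)
have lower x : nrm (T x) ^+ 2 <= M * rin (T x) x.
  have := T0 (x - M^-1%:C *: T x); rewrite (linB lT) (linZ lT) !rinE (sT (T x) x) -!nrmX => h.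
  have h2 := upper (T x).
  have h3 : M^-1 * (M^-1 * rin (T (T x)) (T x)) <= M^-1 * nrm (T x) ^+ 2.
    by rewrite ler_wpM2l ?invr_ge0 ?(ltW M0) // ler_pdivrMl.
  rewrite -ler_pdivrMl //; lra.
pose a := (K ^+ 2 * M)^-1; have a0 : 0 < a by rewrite invr_gt0 mulr_gt0 // exprn_gt0.
exists a, (a + M); split=> //; first by rewrite ltrDl.
move=> x; apply/andP; split; last first.
  by apply: le_trans (upper x) _; rewrite ler_wpM2r ?sqr_ge0 // lerDr ltW.
rewrite ler_pdivrMl; last by rewrite mulr_gt0 // exprn_gt0.
have h : nrm x <= K * nrm (T x) by rewrite -{1}(XT x).
apply: (@le_trans _ _ (K ^+ 2 * nrm (T x) ^+ 2)).
  by rewrite -exprMn ler_sqr ?nnegrE ?mulr_ge0 ?nrm_ge0 // ltW.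
by rewrite -(mulrA (K ^+ 2) M); apply: ler_wpM2l; [exact: sqr_ge0|exact: lower].
Qed.

Lemma pd_on_widen T a b a' b' : 0 < a' <= a -> b <= b' -> pd_on T a b -> pd_on T a' b'.
Proof.
move=> /andP[a'0 a'a] bb' [saT a0 ab hT]; split=> //.
  by apply: le_lt_trans a'a _; exact: lt_le_trans bb'.
move=> x; have /andP[h1 h2] := hT x; apply/andP; split.
  by apply: le_trans h1; rewrite ler_wpM2r ?sqr_ge0.
by apply: le_trans h2 _; rewrite ler_wpM2r ?sqr_ge0.
Qed.

Lemma powR_calc T a b s : pd_on T a b -> calc T a b (fun t => t `^ s) (op_powR T s).
Proof.
move=> [saT a0 ab hT].
have [|X hX] := @calc_exists _ _ T a b (fun t => t `^ s) saT hT.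
  by apply: powR_approximable; rewrite a0.
by rewrite /op_powR (calc_fun_calculus saT hT hX).
Qed.

#[local] Opaque op_powR rin nrm.

Lemma powR_range a b s : 0 < a -> exists a' b', [/\ 0 < a', a' < b' &
  forall t, a <= t <= b -> a' <= t `^ s <= b'].
Proof.
move=> a0; set K := `|s| * (`|ln a| + `|ln b|).
exists (expR (- K)), (expR (K + 1)).
split; first exact: expR_gt0.
  have K0 : 0 <= K by rewrite mulr_ge0 // addr_ge0.
  by rewrite ltr_expR; lra.
move=> t ht; have t0 : 0 < t by case/andP: ht => h _; exact: lt_le_trans h.
have hK : `|s * ln t| <= K by rewrite normrM ler_wpM2l //; exact: ln_bound.
by move: hK; rewrite powR_expR // !ler_expR ler_norml => /andP[]; lra.
Qed.

Lemma powR_pd_on T a b a' b' s : pd_on T a b -> 0 < a' -> a' < b' ->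
  (forall t, a <= t <= b -> a' <= t `^ s <= b') -> pd_on (op_powR T s) a' b'.
Proof.
move=> hT a'0 ab' h; have hc := powR_calc s hT; have [saT a0 ab bT] := hT.
split=> //; first exact: calc_self_adjoint hc.
by apply: (calc_between saT bT hc) => //; exact: ltW.
Qed.

Lemma op_powR_pd T s : positive_definite T -> positive_definite (op_powR T s).
Proof.
move=> /positive_definiteP[a [b hT]]; have [_ a0 _ _] := hT.
have [a' [b' [h1 h2 h3]]] := powR_range b s a0.
by apply/positive_definiteP; exists a', b'; exact: powR_pd_on hT h1 h2 h3.
Qed.

Lemma pd_self_adjoint T : positive_definite T -> self_adjoint T.
Proof. by move=> [/positive_self_adjoint]. Qed.
Lemma pd_symm T : positive_definite T -> symm T.
Proof. by move=> /pd_self_adjoint/self_adjointP[]. Qed.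
Lemma pd_bounded T : positive_definite T -> bounded_op T.
Proof. by move=> /pd_self_adjoint[]. Qed.
Lemma pd_lin T : positive_definite T -> linear T.
Proof. by move=> /pd_bounded[]. Qed.
Lemma pd_ge0 T x : positive_definite T -> 0 <= rin (T x) x.
Proof. by move=> [[_ /(_ x)]]; rewrite lecE /= => /andP[]. Qed.

Lemma op_powRD T s t x : positive_definite T ->
  op_powR T (s + t) x = op_powR T s (op_powR T t x).
Proof.
move=> /positive_definiteP[a [b hT]]; have [saT a0 ab bT] := hT.
have h := calc_mul saT bT (powR_calc s hT) (powR_calc t hT).
have h' : calc T a b (fun u => u `^ s * u `^ t) (op_powR T (s + t)).
  apply: calc_ext (powR_calc _ hT) => u /andP[au _].
  by rewrite powRD // (gt_eqF (lt_le_trans a0 au)) implybT.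
by rewrite (calc_unique saT bT h' h).
Qed.

Lemma op_powR0 T : positive_definite T -> op_powR T 0 = id.
Proof.
move=> /positive_definiteP[a [b hT]]; have [saT a0 ab bT] := hT.
have h : calc T a b (fun u => u `^ 0) (poly_op 1 T).
  by apply: calc_ext (calc_poly a b _ saT.1) => u _; rewrite powRr0 hornerC.
rewrite (calc_unique saT bT (powR_calc 0 hT) h).
by apply/funext => x; rewrite poly_opC scale1r.
Qed.

Lemma op_powR1 T : positive_definite T -> op_powR T 1 = T.
Proof.
move=> /positive_definiteP[a [b hT]]; have [saT a0 ab bT] := hT.
have h : calc T a b (fun u => u `^ 1) (poly_op 'X T).
  apply: calc_ext (calc_poly a b _ saT.1) => u /andP[au _].
  by rewrite powRr1 ?hornerX // ltW // (lt_le_trans a0).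
rewrite (calc_unique saT bT (powR_calc 1 hT) h).
by apply/funext => x; rewrite poly_opX.
Qed.

Lemma op_powRK T s x : positive_definite T -> op_powR T s (op_powR T (- s) x) = x.
Proof. by move=> pT; rewrite -op_powRD // subrr op_powR0. Qed.

Lemma op_powRNK T s x : positive_definite T -> op_powR T (- s) (op_powR T s x) = x.
Proof. by move=> pT; rewrite -op_powRD // addNr op_powR0. Qed.

Lemma op_powRM T s t : positive_definite T ->
  op_powR (op_powR T s) t = op_powR T (s * t).
Proof.
move=> /positive_definiteP[a [b hT]]; have [saT a0 ab bT] := hT.
have [a' [b' [h1 h2 h3]]] := powR_range b s a0.
have hTs := powR_pd_on hT h1 h2 h3.
have h := calc_comp saT bT (powR_calc s hT) h3 (powR_calc t hTs).
apply: (calc_unique saT bT _ (powR_calc (s * t) hT)).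
by apply: calc_ext h => u _; rewrite powRrM.
Qed.

Lemma op_powR_nat T n : positive_definite T -> op_powR T n%:R = iter n T.
Proof.
move=> pT; elim: n => [|n IHn]; first by rewrite op_powR0.
by apply/funext => x; rewrite -add1n natrD op_powRD // IHn op_powR1.
Qed.

(** Conjugation identities such as (D C)^s D = D (C D)^s come from this. *)
Lemma op_powR_intertwine S T K s : positive_definite S -> positive_definite T ->
  bounded_op K -> (forall x, S (K x) = K (T x)) ->
  forall x, op_powR S s (K x) = K (op_powR T s x).
Proof.
move=> /positive_definiteP[a [b hS]] /positive_definiteP[a' [b' hT]] bK hK.
pose a0 := Num.min a a'; pose b0 := Num.max b b'.
have [_ ap _ _] := hS; have [_ a'p _ _] := hT.
have m0 : 0 < a0 by rewrite lt_min ap.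
have hS' : pd_on S a0 b0 by apply: pd_on_widen hS; rewrite ?m0 ?ge_min ?le_max lexx.
have hT' : pd_on T a0 b0 by apply: pd_on_widen hT; rewrite ?m0 ?ge_min ?le_max lexx orbT.
have [saS _ _ bS] := hS'; have [saT _ _ bT] := hT'.
exact: (calc_intertwine saS bS saT bT bK hK (powR_calc s hS') (powR_calc s hT')).
Qed.

(** (D C)^(s+1) = (D C)^s D C = D (C D)^s C. *)
Lemma op_powR_factor C D s : bounded_op C -> bounded_op D ->
  positive_definite (D \o C) -> positive_definite (C \o D) ->
  forall x, op_powR (D \o C) (s + 1) x = D (op_powR (C \o D) s (C x)).
Proof.
move=> bC bD pX pV x; rewrite op_powRD // op_powR1 //=.
exact: (op_powR_intertwine s pX pV bD).
Qed.

Lemma op_powR_continuous T s x : positive_definite T -> 0 <= s <= 1 ->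
  exists2 L, 0 <= L & forall u, 0 <= u <= 1 ->
    `|rin (op_powR T u x) x - rin (op_powR T s x) x| <= L * `|u - s|.
Proof.
move=> /positive_definiteP[a [b hT]] hs; have [saT a0 ab bT] := hT.
have [L L0 hL] := powR_exponent_continuous b s a0.
exists (L * nrm x ^+ 2) => [|u hu]; first by rewrite mulr_ge0 ?sqr_ge0.
have h := calc_add (powR_calc u hT)
  (calc_mul saT bT (calc_poly a b (-1)%:P saT.1) (powR_calc s hT)).
have hb t : a <= t <= b -> `|t `^ u + (-1)%:P.[t] * t `^ s| <= L * `|u - s|.
  by move=> ht; rewrite hornerC mulN1r; exact: hL.
have {h hb}h := calc_nbound saT bT h (mulr_ge0 L0 (normr_ge0 (u - s))) hb.
have hn : nbound (fun x => op_powR T u x - op_powR T s x) (L * `|u - s|).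
  by move=> z; have := h z; rewrite /= poly_opC rmorphN scaleN1r.
rewrite mulrAC; have {}hn := ler_wpM2r (nrm_ge0 x) (hn x).
rewrite -mulrA -expr2 in hn.
have h1 := cauchy_schwarz (op_powR T u x - op_powR T s x) x.
have h2 := cauchy_schwarz (- (op_powR T u x - op_powR T s x)) x.
move: h1 h2; rewrite nrmN !rinE ler_norml; lra.
Qed.

(** * The form order and the Loewner-Heinz inequality *)

Lemma pd_comp_congr S T : positive_definite S -> positive_definite T ->
  positive_definite (S \o T \o S).
Proof.
move=> pS pT; apply: pd_intro => [|x /=|]; last first.
- by apply: invertible_comp; [apply: invertible_comp|]; [case: pS|case: pT|case: pS].
- by rewrite pd_symm //; exact: pd_ge0.
apply/self_adjointP; split.
  exact: bounded_comp (bounded_comp (pd_bounded pS) (pd_bounded pT)) (pd_bounded pS).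
by move=> x y /=; rewrite !pd_symm.
Qed.

Lemma sandwich_pd A B r s : positive_definite A -> positive_definite B ->
  positive_definite (sandwich A B r s).
Proof. by move=> pA pB; apply: pd_comp_congr; exact: op_powR_pd. Qed.

Lemma sandwich_rin A B r s x : positive_definite A ->
  rin (sandwich A B r s x) x = rin (op_powR B s (op_powR A (r / 2) x)) (op_powR A (r / 2) x).
Proof. by move=> pA; rewrite /sandwich /= pd_symm //; exact: op_powR_pd. Qed.

Lemma op_powR_rin_half T s x : positive_definite T ->
  rin (op_powR T s x) x = nrm (op_powR T (s / 2) x) ^+ 2.
Proof.
move=> pT; rewrite nrmX -(pd_symm (op_powR_pd (s / 2) pT)) -op_powRD //.
by rewrite -splitr.
Qed.

(** With u = X^-1 x and v = Y^-1 x, the nonnegative number <Y (u - v), u - v> equals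
    <Y u, u> - 2 <u, x> + <v, x>, and <Y u, u> <= <X u, u> = <u, x>. *)
Lemma ople_inv X Y : positive_definite X -> positive_definite Y ->
  ople Y X -> ople (op_powR X (-1)) (op_powR Y (-1)).
Proof.
move=> pX pY YX x; set u := op_powR X (-1) x; set v := op_powR Y (-1) x.
have Xu : X u = x by rewrite -{1}(op_powR1 pX) op_powRK.
have Yv : Y v = x by rewrite -{1}(op_powR1 pY) op_powRK.
have := pd_ge0 (u - v) pY; have := YX u.
rewrite Xu (linB (pd_lin pY)) rinDl rinNl !rinDr !rinNr Yv (pd_symm pY u v) Yv (rinC u x) (rinC v x); lra.
Qed.

(** Put m = (s+t)/2.  The operator P = A^(-m/2) B^m A^(-m/2) is similar to
    N = A^(-s/2) B^(s/2) B^(t/2) A^(-t/2), a product of contractions by the hypotheses.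
    Hence N - u, and so P - u, is invertible for u > 1, and ||P|| <= 1. *)
Lemma heinz_midpoint A B s t : positive_definite A -> positive_definite B ->
  ople (op_powR B s) (op_powR A s) -> ople (op_powR B t) (op_powR A t) ->
  ople (op_powR B ((s + t) / 2)) (op_powR A ((s + t) / 2)).
Proof.
move=> pA pB hs ht; set m := (s + t) / 2.
pose P := op_powR A (- (m / 2)) \o op_powR B m \o op_powR A (- (m / 2)).
pose G := op_powR A ((t - s) / 4); pose G' := op_powR A (- ((t - s) / 4)).
pose N x := op_powR A (- (s / 2)) (op_powR B m (op_powR A (- (t / 2)) x)).
have pP : positive_definite P by apply: pd_comp_congr; exact: op_powR_pd.
have bN : bounded_op N.
  by apply: bounded_comp (bounded_comp _ _); exact: pd_bounded (op_powR_pd _ _).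
have hPN x : P x = G' (N (G x)).
  rewrite /P /N /G /G' /= -!(op_powRD _ _ _ pA).
  by congr (op_powR A _ (op_powR B m (op_powR A _ x))); rewrite /m; lra.
have contr u x : ople (op_powR B u) (op_powR A u) ->
    nrm (op_powR B (u / 2) (op_powR A (- (u / 2)) x)) <= nrm x.
  move=> hu; rewrite -ler_sqr ?nnegrE ?nrm_ge0 // -op_powR_rin_half //.
  by apply: le_trans (hu _) _; rewrite op_powR_rin_half // op_powRK.
have hN x : rin (N x) x <= nrm x ^+ 2.
  rewrite /N (pd_symm (op_powR_pd _ pA)) (_ : m = s / 2 + t / 2); last by rewrite /m; lra.
  rewrite op_powRD // (pd_symm (op_powR_pd _ pB)) expr2.
  apply: le_trans (cauchy_schwarz _ _) _.
  by apply: ler_pM; rewrite ?nrm_ge0 //; exact: contr.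
have hsp u : spectrum P u%:C -> `|'X.[u]| <= 1.
  have [a [b hab]] := (positive_definiteP P).1 pP; have [saP a0 ab bP] := hab.
  move=> hu; have /andP[au _] := spectrum_between saP bP hu.
  rewrite hornerX ger0_norm; last exact: le_trans (ltW a0) au.
  rewrite leNgt; apply/negP => u1; apply: hu.
  rewrite (_ : (fun x => _) = G' \o (fun x => N x - u%:C *: x) \o G).
    apply: invertible_comp; last by case: (op_powR_pd ((t - s) / 4) pA).
    apply: invertible_comp; first by case: (op_powR_pd (- ((t - s) / 4)) pA).
    apply: (@coercive_shift_invertible _ _ N _ (-1) (u - 1)) => //.
    - by rewrite subr_gt0.
    - by move=> x; have := hN x; rewrite scaleN1r !rinE -nrmX; lra.
  have lG' : linear G' by exact: pd_lin (op_powR_pd _ pA).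
  by apply/funext => x; rewrite hPN /= (linB lG') (linZ lG') /G /G' op_powRNK.
have P1 := poly_op_nbound_spectrum (pd_self_adjoint pP) ler01 hsp.
move=> y; pose x := op_powR A (m / 2) y.
have xy : op_powR A (- (m / 2)) x = y by rewrite op_powRNK.
have -> : rin (op_powR B m y) y = rin (P x) x.
  by rewrite /P /= (pd_symm (op_powR_pd _ pA)) xy.
rewrite op_powR_rin_half // -/x; apply: le_trans (cauchy_schwarz _ _) _.
by have := P1 x; rewrite poly_opX mul1r expr2; apply: ler_wpM2r; exact: nrm_ge0.
Qed.

Lemma heinz_dyadic A B k j : positive_definite A -> positive_definite B ->
  ople B A -> (j <= 2 ^ k)%N ->
  ople (op_powR B (j%:R / 2 ^+ k)) (op_powR A (j%:R / 2 ^+ k)).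
Proof.
move=> pA pB BA; elim: k j => [|k IHk] j hj.
  rewrite expr0 divr1; case: j hj => [|[|j]] // _; first by rewrite !op_powR0.
  by rewrite !op_powR1.
have hu : (uphalf j <= 2 ^ k)%N by rewrite leq_uphalf_double -mul2n -expnS.
have hh : (half j <= 2 ^ k)%N by apply: leq_trans hu; rewrite uphalf_half leq_addl.
have := heinz_midpoint pA pB (IHk _ hh) (IHk _ hu).
rewrite -mulrDl -natrD (_ : (j./2 + uphalf j)%N = j); last first.
  by rewrite uphalf_half addnCA addnn odd_double_half.
by rewrite -mulrA -invfM exprS [2 ^+ k * 2]mulrC.
Qed.

Lemma loewner_heinz A B s : positive_definite A -> positive_definite B ->
  ople B A -> 0 <= s <= 1 -> ople (op_powR B s) (op_powR A s).
Proof.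
move=> pA pB BA /[dup] hs /andP[s0 s1] x; apply/ler_addgt0Pl => e e0.
have [L L0 hL] := op_powR_continuous x pA hs.
have [L' L'0 hL'] := op_powR_continuous x pB hs.
have [||N hN] := @exp_small _ (2^-1) (L + L') e _ _ e0.
- by rewrite invr_ge0 invf_lt1 //; apply/andP; split; lra.
- exact: addr_ge0.
have {hN} := hN N (leqnn N); rewrite exprVn => hN.
have p2 : 0 < 2 ^+ N :> R by rewrite exprn_gt0.
pose j := Num.trunc (s * 2 ^+ N).
have s2 : 0 <= s * 2 ^+ N by rewrite mulr_ge0 // ltW.
have /andP[j1 j2] := truncn_itv s2.
have jN : (j <= 2 ^ N)%N.
  by rewrite -(ler_nat R) natrX; apply: le_trans j1 _; rewrite ler_piMl // ltW.
have hd := heinz_dyadic pA pB BA jN x.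
set u := j%:R / 2 ^+ N in hd.
have u0 : 0 <= u by rewrite divr_ge0 // ltW.
have us : u <= s by rewrite ler_pdivrMr.
have hu : 0 <= u <= 1 by rewrite u0 (le_trans us).
have su : `|u - s| <= (2 ^+ N)^-1.
  rewrite distrC ger0_norm ?subr_ge0 // lerBlDl /u -[X in _ + X]mul1r -mulrDl.
  by rewrite ler_pdivlMr // natr1 ltW.
have h1 := hL u hu; have h2 := hL' u hu.
have h3 : (L + L') * `|u - s| <= e.
  by apply: le_trans hN; rewrite mulrC ler_wpM2r ?addr_ge0.
rewrite mulrDl in h3; move: hd h1 h2 h3.
move: (rin (op_powR B u x) x) (rin (op_powR A u x) x) (rin (op_powR B s x) x)
  (rin (op_powR A s x) x) => bu au bs as_ hd.
by rewrite !ler_norml => /andP[] + + /andP[]; lra.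
Qed.

(** * Furuta inequality *)

(** [op_powR_factor] for C = A^(p/2) B^(r/2) and its adjoint D. *)
Lemma sandwich_swap_factor A B r p s x : positive_definite A -> positive_definite B ->
  rin (op_powR (sandwich B A r p) (s + 1) x) x =
  rin (op_powR (sandwich A B p r) s (op_powR A (p / 2) (op_powR B (r / 2) x)))
    (op_powR A (p / 2) (op_powR B (r / 2) x)).
Proof.
move=> pA pB.
pose C := op_powR A (p / 2) \o op_powR B (r / 2).
pose D := op_powR B (r / 2) \o op_powR A (p / 2).
have eX : sandwich B A r p = D \o C.
  by apply/funext => z; rewrite /sandwich /C /D /= -op_powRD // -splitr.
have eV : sandwich A B p r = C \o D.
  by apply/funext => z; rewrite /sandwich /C /D /= -op_powRD // -splitr.
have bC : bounded_op C by apply: bounded_comp; exact: pd_bounded (op_powR_pd _ _).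
have bD : bounded_op D by apply: bounded_comp; exact: pd_bounded (op_powR_pd _ _).
have pX : positive_definite (D \o C) by rewrite -eX; exact: sandwich_pd.
have pV : positive_definite (C \o D) by rewrite -eV; exact: sandwich_pd.
rewrite eX eV (op_powR_factor _ bC bD pX pV).
by rewrite /D /= (pd_symm (op_powR_pd _ pB)) (pd_symm (op_powR_pd _ pA)).
Qed.

(** With e = (1+r)/(p+r) and V = A^(p/2) B^r A^(p/2), the right-hand side is
    B^(r/2) A^(p/2) V^(e-1) A^(p/2) B^(r/2).  As r <= 1, V <= A^(p+r); raising to the
    power 1-e and inverting gives V^(e-1) >= A^(1-p), which leaves B^(r/2) A B^(r/2). *)
Lemma furuta_small A B p r : positive_definite A -> positive_definite B ->
  ople B A -> 1 <= p -> 0 <= r <= 1 ->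
  ople (op_powR B (1 + r)) (op_powR (sandwich B A r p) ((1 + r) / (p + r))).
Proof.
move=> pA pB BA p1 /[dup] hr /andP[r0 r1] x.
have pr : 0 < p + r by lra.
set e := _ / _; have he : 0 <= 1 - e <= 1.
  rewrite /e; apply/andP; split.
    by rewrite subr_ge0 ler_pdivrMr // mul1r; lra.
  by rewrite lerBlDr lerDl divr_ge0 //; lra.
have pV : positive_definite (sandwich A B p r) by exact: sandwich_pd.
have VA : ople (sandwich A B p r) (op_powR A (p + r)).
  move=> z; rewrite sandwich_rin //; apply: le_trans (loewner_heinz pA pB BA hr _) _.
  rewrite -(pd_symm (op_powR_pd _ pA)) -!(op_powRD _ _ _ pA).
  by rewrite (_ : p / 2 + r + p / 2 = p + r) //; lra.
have h1 := loewner_heinz (op_powR_pd (p + r) pA) pV VA he.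
have h2 := ople_inv (op_powR_pd _ (op_powR_pd _ pA)) (op_powR_pd _ pV) h1.
rewrite (op_powRM (p + r) (1 - e) pA) (op_powRM ((p + r) * (1 - e)) (-1) pA) in h2.
rewrite (op_powRM (1 - e) (-1) pV) -mulrA in h2.
rewrite (_ : (p + r) * ((1 - e) * -1) = 1 - p) in h2; last first.
  by rewrite /e; field; exact: lt0r_neq0.
rewrite (_ : e = (1 - e) * -1 + 1); last lra.
rewrite (sandwich_swap_factor r p _ x pA pB).
set y := op_powR A (p / 2) _; apply: le_trans (h2 y); rewrite {}/y.
rewrite -(pd_symm (op_powR_pd _ pA)) -!(op_powRD _ _ _ pA).
rewrite (_ : p / 2 + (1 - p) + p / 2 = 1); last lra.
rewrite op_powR1 //; apply: le_trans (BA _).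
have eB y : B y = op_powR B 1 y by rewrite op_powR1.
rewrite eB -(pd_symm (op_powR_pd _ pB)) -!(op_powRD _ _ _ pB).
by rewrite (_ : r / 2 + 1 + r / 2 = 1 + r) //; lra.
Qed.

(** The case q = (r-1)/2 yields operators B^(1+q) <= (B^(q/2) A^p B^(q/2))^e to which
    [furuta_small] applies with exponents (p+q)/(1+q) and 1; the result is the case
    r = 2q+1.  The induction is on a bound n for r, which passing from r to q lowers. *)
Lemma furuta_critical n A B p r : positive_definite A -> positive_definite B ->
  ople B A -> 1 <= p -> 0 <= r <= n%:R ->
  ople (op_powR B (1 + r)) (op_powR (sandwich B A r p) ((1 + r) / (p + r))).
Proof.
move=> pA pB BA p1; elim: n r => [|n IHn] r /andP[r0 rn].
  by apply: furuta_small => //; rewrite r0 (le_trans rn).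
have [r1|r1] := leP r 1; first by apply: furuta_small => //; rewrite r0.
pose q := (r - 1) / 2.
have q0 : 0 <= q by rewrite /q; lra.
have hq : 0 <= q <= n%:R by rewrite q0 /q; move: rn; rewrite -natr1 => rn; have := ler0n R n; lra.
have h1 := IHn q hq; set e := _ / _ in h1.
have pq : 0 < p + q by lra.
have q1 : 0 < 1 + q by lra.
have pX : positive_definite (sandwich B A q p) by exact: sandwich_pd.
have p1' : 1 <= (p + q) / (1 + q) by rewrite ler_pdivlMr // mul1r lerD2r.
have hr1 : 0 <= (1 : R) <= 1 by rewrite ler01 lexx.
have := furuta_small (op_powR_pd e pX) (op_powR_pd (1 + q) pB) h1 p1' hr1.
rewrite (op_powRM (1 + q) (1 + 1) pB) (_ : (1 + q) * (1 + 1) = 1 + r); last by rewrite /q; lra.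
rewrite (_ : (1 + 1) / ((p + q) / (1 + q) + 1) = (1 + r) / (p + r)); last first.
  by rewrite /q; field; rewrite !gt_eqF //; lra.
rewrite (_ : sandwich (op_powR B (1 + q)) _ 1 _ = sandwich B A r p) //.
apply/funext => x; rewrite {1}/sandwich !(op_powRM _ _ pB) (op_powRM _ _ pX).
rewrite (_ : e * ((p + q) / (1 + q)) = 1); last first.
  by rewrite /e; field; rewrite !gt_eqF.
rewrite (op_powR1 pX) /= -!(op_powRD _ _ _ pB).
by congr (op_powR B _ (op_powR A p (op_powR B _ x))); rewrite /q; lra.
Qed.

(** For p >= 1 the exponent c is at most the critical one, from which Loewner-Heinz
    descends; for p <= 1 Loewner-Heinz applies directly, first to p and then to c. *)
Lemma furuta_inequality A B p r c : positive_definite A -> positive_definite B ->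
  ople B A -> 0 <= p -> 0 <= r -> 0 <= c <= 1 -> c * (p + r) <= 1 + r ->
  ople (op_powR B (c * (p + r))) (op_powR (sandwich B A r p) c).
Proof.
move=> pA pB BA p0 r0 /[dup] hc /andP[c0 c1] hcp.
have pX : positive_definite (sandwich B A r p) by exact: sandwich_pd.
have [p1|p1] := leP p 1.
  have hBA : ople (op_powR B (p + r)) (sandwich B A r p).
    move=> x; rewrite sandwich_rin //.
    have hp : 0 <= p <= 1 by rewrite p0.
    apply: le_trans (loewner_heinz pA pB BA hp _).
    rewrite -(pd_symm (op_powR_pd _ pB)) -!(op_powRD _ _ _ pB).
    by rewrite (_ : r / 2 + p + r / 2 = p + r) //; lra.
  have := loewner_heinz pX (op_powR_pd (p + r) pB) hBA hc.
  by rewrite (op_powRM _ _ pB) mulrC.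
pose n := (Num.trunc r).+1.
have hr : 0 <= r <= n%:R by rewrite r0 ltW // truncnS_gt.
have h := furuta_critical pA pB BA (ltW p1) hr.
pose g := c * (p + r) / (1 + r).
have r1 : 0 < 1 + r by lra.
have pr : 0 < p + r by lra.
have hg : 0 <= g <= 1.
  rewrite /g ler_pdivrMr // mul1r hcp andbT divr_ge0 ?mulr_ge0 //; lra.
have := loewner_heinz (op_powR_pd _ pX) (op_powR_pd (1 + r) pB) h hg.
rewrite (op_powRM _ _ pB) (op_powRM _ _ pX) (_ : (1 + r) * g = c * (p + r)); last first.
  by rewrite /g; field; exact: lt0r_neq0.
rewrite (_ : (1 + r) / (p + r) * g = c) //.
by rewrite /g; field; rewrite !gt_eqF.
Qed.

(** * The equivalences *)

Lemma op_invE T X : is_op_inverse T X -> op_inv T = X.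
Proof.
move=> hX; apply: xget_unique => // Y [_ _ TY]; have [_ TX _] := hX.
by apply/funext => x; rewrite -{2}(TY x) TX.
Qed.

Lemma pd_op_inv S : positive_definite S ->
  [/\ positive_definite (op_inv S), cancel S (op_inv S) & cancel (op_inv S) S].
Proof.
move=> pS.
have hS : is_op_inverse S (op_powR S (-1)).
  split; first exact: pd_bounded (op_powR_pd _ pS).
  - by move=> x; rewrite -{2}(op_powR1 pS) op_powRNK.
  - by move=> x; rewrite -{1}(op_powR1 pS) op_powRK.
by rewrite (op_invE hS); case: hS => ? ? ?; split=> //; exact: op_powR_pd.
Qed.

Lemma opnorm_le1 S : positive_definite S -> opnorm S <= 1 <-> ople S id.
Proof.
move=> pS; have bS := pd_bounded pS; split=> [h x|h].
  apply: le_trans (cauchy_schwarz _ _) _; rewrite -nrmX expr2.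
  by rewrite ler_wpM2r ?nrm_ge0 // -[leRHS]mul1r; exact: nbound_le h (opnorm_nbound bS) x.
have [a [b [saS a0 ab hS]]] := (positive_definiteP S).1 pS.
apply: opnorm_le => // x; rewrite -poly_opX.
have hS1 : between S a 1.
  by move=> z; have /andP[-> _] := hS z; rewrite mul1r nrmX; exact: h.
apply: (poly_op_nbound saS hS1) => // t /andP[at_ t1].
by rewrite hornerX ger0_norm // (le_trans _ at_) // ltW.
Qed.

Lemma iter_pd_inj n S T : (0 < n)%N -> positive_definite S -> positive_definite T ->
  iter n S = iter n T -> S = T.
Proof.
move=> n0 pS pT; rewrite -!op_powR_nat // => e.
have nn : n%:R * n%:R^-1 = 1 :> R by rewrite mulfV // pnatr_eq0 -lt0n.
rewrite -(op_powR1 pS) -(op_powR1 pT) -nn.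
by rewrite -(op_powRM _ _ pS) -(op_powRM _ _ pT) e.
Qed.

(** Positive n-th roots are unique, so Y^(1/2) S^-1 Y^(1/2) must be X^(1+1/n). *)
Lemma power_equation_solution X Y S n : (0 < n)%N ->
  positive_definite X -> positive_definite Y -> positive_definite S ->
  iter n.+1 X = iter n (op_powR Y (1 / 2) \o op_inv S \o op_powR Y (1 / 2)) <->
  S = op_powR Y (1 / 2) \o op_powR (op_powR X (1 + n%:R^-1)) (-1) \o op_powR Y (1 / 2).
Proof.
move=> n0 pX pY pS; set Z := op_powR X (1 + n%:R^-1); set h := op_powR Y (1 / 2).
have nn : (n%:R : R) != 0 by rewrite pnatr_eq0 -lt0n.
have pZ : positive_definite Z by exact: op_powR_pd.
have ph : positive_definite h by exact: op_powR_pd.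
have [pI SK KS] := pd_op_inv pS.
have -> : iter n.+1 X = iter n Z.
  rewrite -(op_powR_nat _ pX) -(op_powR_nat _ pZ) /Z (op_powRM _ _ pX).
  by rewrite mulrDl mul1r mulVf // natr1.
have h_inj : injective h by move=> u v e; rewrite -(op_powRNK (1 / 2) u pY) -/h e op_powRNK.
have ZK u : Z (op_powR Z (-1) u) = u by rewrite -{1}(op_powR1 pZ) op_powRK.
have KZ u : op_powR Z (-1) (Z u) = u by rewrite -{2}(op_powR1 pZ) op_powRNK.
split=> [e|eS].
  have {}e := iter_pd_inj n0 pZ (pd_comp_congr ph pI) e.
  apply/funext => x /=; set w := op_powR Z (-1) (h x).
  have : Z w = h (op_inv S (h w)) by rewrite {1}e.
  by rewrite ZK => /h_inj ->; rewrite KS.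
congr (iter n _); apply/funext => x /=.
by have := KS (h x); rewrite {1}eS => /h_inj/(congr1 Z); rewrite ZK.
Qed.

(** The unique candidate S = Y^(1/2) Z^-1 Y^(1/2) satisfies S <= 1 iff Z^-1 <= Y^-1. *)
Lemma power_equationP X Y n : (0 < n)%N -> positive_definite X -> positive_definite Y ->
  ople Y (op_powR X (1 + n%:R^-1)) <->
  exists! S : H -> H, [/\ positive_definite S, opnorm S <= 1 &
    iter n.+1 X = iter n (op_powR Y (1 / 2) \o op_inv S \o op_powR Y (1 / 2))].
Proof.
move=> n0 pX pY; have hsol S := power_equation_solution n0 pX pY (S := S).
set Z := op_powR X (1 + n%:R^-1) in hsol *.
have pZ : positive_definite Z by exact: op_powR_pd.
set h := op_powR Y (1 / 2) in hsol *; have ph : positive_definite h by exact: op_powR_pd.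
pose S := h \o op_powR Z (-1) \o h.
have pS : positive_definite S by apply: pd_comp_congr => //; exact: op_powR_pd.
have YN x : rin (op_powR Y (-1) (h x)) (h x) = rin x x.
  rewrite -(pd_symm ph) /h -!(op_powRD _ _ _ pY).
  by rewrite (_ : 1 / 2 + -1 + 1 / 2 = 0) ?op_powR0 //; lra.
have inv2 T : positive_definite T -> op_powR (op_powR T (-1)) (-1) = T.
  by move=> pT; rewrite (op_powRM _ _ pT) mulrNN mulr1 op_powR1.
have SZ : ople S id <-> ople Y Z.
  split=> [hS|YZ x]; last first.
    by rewrite /S /= (pd_symm ph) -(YN x); exact: ople_inv.
  rewrite -(inv2 _ pZ) -(inv2 _ pY); apply: ople_inv; try exact: op_powR_pd.
  move=> y; rewrite -(op_powRK (1 / 2) y pY) -/h YN.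
  by rewrite -(pd_symm ph); exact: hS.
split=> [/SZ hS|[S' [[pS' nS' /(hsol _ pS') eS'] _]]].
  exists S; split=> [|S' [pS' _ /(hsol _ pS') ->]] //; split=> //.
    exact/opnorm_le1.
  exact/(hsol _ pS).
by apply/SZ; rewrite /S -eS'; exact/opnorm_le1.
Qed.

(** By [sandwich_swap_factor] the claim is the Furuta inequality with the pair (r, p0) of
    exponents exchanged, conjugated by B^(p0/2) A^(r/2); the admissible range of p is
    the condition (r + p0)/n <= 1 + p0. *)
Lemma ople_power_inequality A B n r p0 p : positive_definite A -> positive_definite B ->
  (0 < n)%N -> ople B A -> admissible n r p0 p ->
  ople (sandwich A B r p) (op_powR (sandwich A B r p0) (1 + n%:R^-1)).
Proof.
move=> pA pB n0 BA [r0 hp pp p00 hn] x.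
have n0' : 0 < n%:R :> R by rewrite ltr0n.
have n1 : 1 <= n%:R :> R by rewrite ler1n.
have hc : 0 <= (n%:R^-1 : R) <= 1.
  by rewrite invr_ge0 (ltW n0') /= invf_le1.
have ep : n%:R^-1 * (r + p0) = p - p0.
  apply: (mulfI (lt0r_neq0 n0')); rewrite mulrA mulfV ?mul1r ?lt0r_neq0 //.
  by move: hn; rewrite -natr1; lra.
have hle : n%:R^-1 * (r + p0) <= 1 + p0.
  rewrite ep; have : Num.min 1 r <= 1 by rewrite ge_min lexx.
  by move: hp; lra.
have hF := furuta_inequality pA pB BA r0 p00 hc hle.
rewrite addrC (sandwich_swap_factor r p0 _ x pB pA).
set w := op_powR A (r / 2) x; apply: le_trans (hF _).
rewrite ep -(pd_symm (op_powR_pd _ pB)) -!(op_powRD _ _ _ pB).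
rewrite (_ : p0 / 2 + (p - p0) + p0 / 2 = p); last lra.
by rewrite sandwich_rin.
Qed.

(** For p0 = 0 both sides are conjugates by A^(n/2), of B and of A. *)
Lemma power_inequality_ople A B n : positive_definite A -> positive_definite B ->
  (0 < n)%N ->
  ople (sandwich A B n%:R 1) (op_powR (sandwich A B n%:R 0) (1 + n%:R^-1)) -> ople B A.
Proof.
move=> pA pB n0 h y; have nn : (n%:R : R) != 0 by rewrite pnatr_eq0 -lt0n.
pose x := op_powR A (- (n%:R / 2)) y.
have xy : op_powR A (n%:R / 2) x = y by rewrite /x op_powRK.
have := h x; rewrite sandwich_rin // xy op_powR1 //.
have -> : sandwich A B n%:R 0 = op_powR A n%:R.
  by apply/funext => z; rewrite /sandwich /= op_powR0 // -op_powRD // -splitr.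
rewrite (op_powRM _ _ pA) mulrDr mulr1 mulfV //.
rewrite (_ : n%:R + 1 = n%:R / 2 + 1 + n%:R / 2); last lra.
by rewrite !(op_powRD _ _ _ pA) (pd_symm (op_powR_pd _ pA)) xy op_powR1.
Qed.

Lemma admissible_order n : (0 < n)%N -> admissible n (n%:R : R) 0 1.
Proof.
move=> n0; have n1 : 1 <= n%:R :> R by rewrite ler1n.
split=> //.
  by rewrite mulr0 add0r le_min lexx.
by rewrite -natr1; ring.
Qed.
End Powers.

Theorem theorem3p3 (R : realType) (H : hilbertType R) (A B : H -> H)
    (hA : positive_definite A) (hB : positive_definite B)
    (n : nat) (hn : (0 < n)%N) :
  [/\ (op_le B A /\ positive_definite B) <->
        (forall r p0 p : R, admissible n r p0 p ->
           power_inequality A B n r p0 p),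
      (op_le B A /\ positive_definite B) <->
        (forall r p0 p : R, admissible n r p0 p ->
           power_equation A B n r p0 p)
    & forall r p0 p : R, admissible n r p0 p ->
        (power_inequality A B n r p0 p <-> power_equation A B n r p0 p)].
Proof.
have ineqP r p0 p : power_inequality A B n r p0 p <->
    ople (sandwich A B r p) (op_powR (sandwich A B r p0) (1 + n%:R^-1)).
  split=> [/op_leE[]//|h]; apply/op_leE.
  by split=> //; apply: pd_self_adjoint; [apply: op_powR_pd|]; exact: sandwich_pd.
have ineq_eq r p0 p : power_inequality A B n r p0 p <-> power_equation A B n r p0 p.
  apply: iff_trans (ineqP r p0 p) _.
  by apply: power_equationP => //; exact: sandwich_pd.
have order_ineq : (op_le B A /\ positive_definite B) <->
    (forall r p0 p : R, admissible n r p0 p -> power_inequality A B n r p0 p).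
  split=> [[/op_leE[_ _ BA] _] r p0 p adm|h].
    by apply/ineqP; exact: ople_power_inequality.
  split=> //; apply/op_leE; split; try exact: pd_self_adjoint.
  by apply: (power_inequality_ople hA hB hn); apply/ineqP/h; exact: admissible_order.
split=> [||r p0 p _]; [exact: order_ineq| |exact: ineq_eq].
apply: iff_trans order_ineq _.
by split=> h r p0 p adm; apply/ineq_eq; exact: h.
Qed.
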